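(* The generic type of the equation $$\frac{z''}{z'}=z$$ is 2-step analyzable in the constants and is not internal to the constants.
   Context: $(\mathcal{U},\delta)$ is a saturated model of $DCF_0$ with field of constants $\mathbb{C}$, $z'=\delta(z)$. The generic type is the type of a solution $z\in\mathcal{U}$ with $z,z'$ algebraically independent over the (small, e.g. countable) base field of constants $K$, e.g. $K=\mathbb{Q}^{alg}$. $K\langle y\rangle$ is the differential field generated by $y$ over $K$. A complete type $p$ over a differential field $K$ is internal to the constants if there is a (small) differential field extension $F\supseteq K$ such that every realization $y$ of $p$ lies in $F(c_1,\ldots,c_k)$ for some constants $c_1,\ldots,c_k\in\mathbb{C}$. $\operatorname{tp}(y/K)$ is analyzable in the constants if there is a sequence $(y_0,\ldots,y_n)$ with $y\in K\langle y_0,\ldots,y_n\rangle^{alg}$ and, for each $i$, either $y_i\in K\langle y_0,\ldots,y_{i-1}\rangle^{alg}$ or $\operatorname{tp}(y_i/K\langle y_0,\ldots,y_{i-1}\rangle)$ is stationary and internal to the constants; it is 2-step analyzable if such a sequence of length two, $(y_0,y_1)$, exists. *)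

(* Defs.v *)
From mathcomp Require Import all_boot all_order all_algebra.
From mathcomp Require Import mpoly.
From mathcomp Require Import mathcomp_extra boolp classical_sets functions.
From mathcomp Require Import cardinality.

Set Implicit Arguments.
Unset Strict Implicit.
Unset Printing Implicit Defensive.

Import GRing.Theory.

Local Open Scope classical_set_scope.
Local Open Scope card_scope.
Local Open Scope ring_scope.

(* A differential field is a pair (U, d) of a field and a derivation. *)

Definition derivation (U : fieldType) (d : U -> U) : Prop :=
  (forall x y, d (x + y) = d x + d y) /\
  (forall x y, d (x * y) = d x * y + x * d y).

Definition constants (U : fieldType) (d : U -> U) : set U :=
  [set x | d x = 0].

Definition subfield (U : fieldType) (A : set U) : Prop :=
  divring_closed (mem A).

Definition diff_subfield (U : fieldType) (d : U -> U) (A : set U) : Prop :=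
  subfield A /\ (forall x, A x -> A (d x)).

Definition field_gen (U : fieldType) (A : set U) : set U :=
  smallest (@subfield U) A.

Definition diff_field_gen (U : fieldType) (d : U -> U) (A : set U) : set U :=
  smallest (diff_subfield d) A.

(* K<y_0, ..., y_{k-1}> for s = [:: y_0; ...; y_{k-1}] *)
Definition diff_adjoin (U : fieldType) (d : U -> U) (K : set U) (s : seq U)
  : set U := diff_field_gen d (K `|` [set` s]).

(* K(y_0, ..., y_{k-1}) *)
Definition adjoin (U : fieldType) (K : set U) (s : seq U) : set U :=
  field_gen (K `|` [set` s]).

(* the relative algebraic closure of the subfield A in U *)
Definition alg_closure (U : fieldType) (A : set U) : set U :=
  [set x | exists p : {poly U}, [/\ p \is a polyOver (mem A), p != 0 & root p x]].

Definition alg_indep (U : fieldType) (A : set U) (n : nat) (v : n.-tuple U)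
  : Prop :=
  forall p : {mpoly U[n]},
    p \is a mpolyOver n (mem A) -> p.@[tnth v] = 0 -> p = 0.

(* First-order formulas, with parameters in U, in the language
   {0, 1, +, -, *, delta} of differential rings.  Variables are de Bruijn
   indices: Ex binds the variable 0. *)

Inductive term (U : Type) : Type :=
| Var of nat
| Par of U
| Zero
| One
| Add of term U & term U
| Opp of term U
| Mul of term U & term U
| Der of term U.

Inductive formula (U : Type) : Type :=
| Eq of term U & term U
| Not of formula U
| And of formula U & formula U
| Ex of formula U.

(* Variables not covered by the environment e denote 0, a constant of the
   language; hence in [holds d [:: x] f] every f is a formula in one variable. *)
Fixpoint eval (U : fieldType) (d : U -> U) (e : seq U) (t : term U) : U :=
  match t with
  | Var i => nth 0 e i
  | Par a => a
  | Zero => 0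
  | One => 1
  | Add t1 t2 => eval d e t1 + eval d e t2
  | Opp t1 => - eval d e t1
  | Mul t1 t2 => eval d e t1 * eval d e t2
  | Der t1 => d (eval d e t1)
  end.

Fixpoint holds (U : fieldType) (d : U -> U) (e : seq U) (f : formula U)
  : Prop :=
  match f with
  | Eq t1 t2 => eval d e t1 = eval d e t2
  | Not f1 => ~ holds d e f1
  | And f1 f2 => holds d e f1 /\ holds d e f2
  | Ex f1 => exists x, holds d (x :: e) f1
  end.

Fixpoint term_over (U : Type) (A : set U) (t : term U) : Prop :=
  match t with
  | Var _ | Zero | One => True
  | Par a => A a
  | Add t1 t2 | Mul t1 t2 => term_over A t1 /\ term_over A t2
  | Opp t1 | Der t1 => term_over A t1
  end.

Fixpoint formula_over (U : Type) (A : set U) (f : formula U) : Prop :=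
  match f with
  | Eq t1 t2 => term_over A t1 /\ term_over A t2
  | Not f1 | Ex f1 => formula_over A f1
  | And f1 f2 => formula_over A f1 /\ formula_over A f2
  end.

(* 1-types, as sets of formulas. *)

Definition realizes (U : fieldType) (d : U -> U) (x : U) (p : set (formula U))
  : Prop := forall f, p f -> holds d [:: x] f.

Definition finitely_satisfiable (U : fieldType) (d : U -> U)
  (p : set (formula U)) : Prop :=
  forall q, finite_set q -> q `<=` p -> exists x, realizes d x q.

Definition complete_type (U : fieldType) (d : U -> U) (A : set U)
  (p : set (formula U)) : Prop :=
  [/\ p `<=` formula_over A, finitely_satisfiable d p
    & forall f, formula_over A f -> p f \/ p (Not f)].

Definition tp (U : fieldType) (d : U -> U) (A : set U) (x : U)
  : set (formula U) :=
  [set f | formula_over A f /\ holds d [:: x] f].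

(* A is small when its cardinality is less than that of U. *)
Definition small (U : fieldType) (A : set U) : Prop :=
  ~~ ([set: U] #<= A).

Definition saturated (U : fieldType) (d : U -> U) : Prop :=
  forall (A : set U) (p : set (formula U)),
    small A -> p `<=` formula_over A -> finitely_satisfiable d p ->
    exists x, realizes d x p.

(* Blum's axioms.  A differential polynomial in U{X} of order less than n is a
   polynomial in X, X', ..., X^(n-1).  Nonzero elements of U have order less
   than 0, so n = 0 says that U is algebraically closed. *)

Definition diff_eval (U : fieldType) (d : U -> U) (n : nat)
  (f : {mpoly U[n]}) (x : U) : U := f.@[fun i : 'I_n => iter i d x].

Definition has_order (U : fieldType) (n : nat) (f : {mpoly U[n.+1]}) : Prop :=
  exists2 m : 'X_{1..n.+1}, m \in msupp f & m ord_max != 0%N.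

Definition differentially_closed (U : fieldType) (d : U -> U) : Prop :=
  forall (n : nat) (f : {mpoly U[n.+1]}) (g : {mpoly U[n]}),
    has_order f -> g != 0 ->
    exists x, diff_eval d f x = 0 /\ diff_eval d g x != 0.

Definition saturated_DCF0 (U : fieldType) (d : U -> U) : Prop :=
  [/\ [pchar U] =i pred0, derivation d, differentially_closed d
    & saturated d].

(* Forking and stationarity, via Morley rank: DCF_0 is omega-stable, and there
   an extension of a complete type is nonforking exactly when it has the same
   Morley rank.  osup f is the least ordinal greater than all the f i; thus
   morley_ge c f says that f is consistent and that for every b < c the
   definable set f contains infinitely many pairwise disjoint definable sets
   of Morley rank at least b. *)

Inductive ordinal_tree : Type :=
| osup (T : Type) (f : T -> ordinal_tree).

Fixpoint morley_ge (U : fieldType) (d : U -> U) (c : ordinal_tree)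
  (f : formula U) : Prop :=
  match c with
  | osup T b =>
      (exists x, holds d [:: x] f) /\
      (forall i : T, exists g : nat -> formula U,
        [/\ forall n x, holds d [:: x] (g n) -> holds d [:: x] f,
            forall m n x, m <> n ->
              holds d [:: x] (g m) -> ~ holds d [:: x] (g n)
          & forall n, morley_ge d (b i) (g n)])
  end.

(* The rank of a type is the least rank of its formulas. *)
Definition type_morley_ge (U : fieldType) (d : U -> U) (c : ordinal_tree)
  (p : set (formula U)) : Prop := forall f, p f -> morley_ge d c f.

Definition nonforking_extension (U : fieldType) (d : U -> U)
  (p : set (formula U)) (B : set U) (q : set (formula U)) : Prop :=
  [/\ complete_type d B q, p `<=` q
    & forall c, type_morley_ge d c q <-> type_morley_ge d c p].

Definition stationary (U : fieldType) (d : U -> U) (A : set U)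
  (p : set (formula U)) : Prop :=
  forall B : set U, A `<=` B -> small B ->
    exists! q, nonforking_extension d p B q.

Definition internal (U : fieldType) (d : U -> U) (K : set U)
  (p : set (formula U)) : Prop :=
  exists F : set U,
    [/\ diff_subfield d F, small F, K `<=` F
      & forall y, realizes d y p ->
          exists2 c : seq U, [set` c] `<=` constants d & adjoin F c y].

(* s = [:: y_0; ...; y_n] is an analysis of tp(y/K) in the constants. *)
Definition analysis (U : fieldType) (d : U -> U) (K : set U) (y : U)
  (s : seq U) : Prop :=
  alg_closure (diff_adjoin d K s) y /\
  forall i, (i < size s)%N ->
    let L := diff_adjoin d K (take i s) in
    let yi := nth 0 s i in
    alg_closure L yi \/
    (stationary d L (tp d L yi) /\ internal d L (tp d L yi)).

Definition analyzable_in_steps (U : fieldType) (d : U -> U) (n : nat)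
  (K : set U) (y : U) : Prop :=
  exists2 s : seq U, size s = n & analysis d K y s.

(* Main.v *)
Require Import Defs.
From mathcomp Require Import all_boot all_order all_algebra.
From mathcomp Require Import mpoly.
From mathcomp Require Import mathcomp_extra boolp classical_sets functions.
From mathcomp Require Import cardinality zify ring.

(** Let c = z' - z^2 / 2. The equation z'' = z z' says that c' = 0, so c is a constant and
z solves the Riccati equation z' = z^2 / 2 + c over K(c). If z and z' are algebraically
independent over K, then c is transcendental over K and z is transcendental over K(c).

Analyzability. The analysis is (c, z). The type of the constant c is internal. If a^2 = -2 c,
the substitution t = (z - a) / (z + a) turns the Riccati equation into t' = a t, whose
solutions are the constant multiples of one nonzero solution t0; hence every solution z is
rational over c, a, t0 and one constant, and the type of z over K(c) is internal
([riccati_exp], [z_step]).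

Both types are generic types of an equation x' = g(x) of order 1, and these are stationary
([stationary_generic]). Indeed, any two solutions that are transcendental over a differential field
have the same type over it ([generic_equiv]), so the equation defines a strongly minimal
set; its generic type has Morley rank 1, and its only nonforking extension to B is the type
of the solutions transcendental over B. The equality of types comes from quantifier
elimination for differentially closed fields ([qf_equiv_elementary]), which is proved by
back-and-forth ([forth]): an isomorphism between small differential rings of a saturated model
extends to any further element x, by matching first the algebraically independent derivatives
of x and then the minimal polynomial of the next one. An isomorphism is represented by its graph,
a subring of U * U in which a pair has either both coordinates zero or none. Smallness is kept
along the way because the generated rings are images of sets of terms, and the terms over
an infinite set B are no more numerous than B ([card_terms_over]).

Non-internality. Suppose that every realization of the type of z is rational over a small
differential field F and constants. Choose a constant a transcendental over F and a solution y of
y' = (y^2 - a^2) / 2 transcendental over F and a. It realizes the type of z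
([generic_realizes]), so t = (y - a) / (y + a) is a nonzero solution of t' = a t in F(C). There is
none: in F(a) it is excluded by comparing degrees in a ([no_exp_transcendental]), and a
nonzero solution in M(c), for a constant c, yields one in M ([no_exp_const]). *)

Set Implicit Arguments.
Unset Strict Implicit.
Unset Printing Implicit Defensive.
Import GRing.Theory.

Local Open Scope classical_set_scope.
Local Open Scope card_scope.
Local Open Scope ring_scope.

(** * Infinite cardinals *)

Definition choose_or T (x0 : T) (P : set T) : T :=
  if pselect (exists x, P x) is left e then sval (cid e) else x0.

Lemma choose_orP T (x0 : T) (P : set T) : (exists x, P x) -> P (choose_or x0 P).
Proof. by rewrite /choose_or; case: pselect => // e _; case: (cid e). Qed.

Lemma card_leE T (X : Type) (x0 : X) (A : set T) (B : set X) :
  A #<= B <-> exists f : T -> X, (forall x, A x -> B (f x)) /\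
    (forall x y, A x -> A y -> f x = f y -> x = y).
Proof.
split.
  case/card_leP => f.
  pose F (x : T) : X := if pselect (A x) is left Ax then sval (f (SigSub (mem_set Ax))) else x0.
  exists F; split.
    move=> x Ax; rewrite /F; case: pselect => // Ax'.
    by case: (f _) => y /= By; apply: set_mem.
  move=> x y Ax Ay; rewrite /F; case: pselect => // Ax'; case: pselect => // Ay'.
  move=> /val_inj /(inj (f := f)) H.
  by have /(congr1 val) := H (mem_set I) (mem_set I).
case=> f [fAB finj].
have finj' : {in A &, injective f} by move=> x y /set_mem Ax /set_mem Ay; apply: finj.
apply: (@card_le_trans _ _ _ (f @` A)).
  by have /card_eqPle[] := inj_card_eq finj'.
by apply: subset_card_le => _ [x Ax <-]; apply: fAB.
Qed.

(** By Zorn's lemma there is a maximal partial bijection between A and B; it must be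
    total on one of the two sides. *)
Lemma card_le_total T (X : Type) (A : set T) (B : set X) : A #<= B \/ B #<= A.
Proof.
pose P (G : set (T * X)) := (forall p, G p -> A p.1 /\ B p.2) /\
  (forall p q, G p -> G q -> p.1 = q.1 <-> p.2 = q.2).
have [F FP totF|G [[GAB Ginj] Gmax]] := @Zorn_bigcup _ P.
  split=> [p [H /FP [HAB _] Hp]|p q [H FH Hp] [H' FH' H'q]]; first exact: HAB.
  have [HH|HH] := totF _ _ FH FH'.
    by have [_ K] := FP _ FH'; apply: K => //; apply: HH.
  by have [_ K] := FP _ FH; apply: K => //; apply: HH.
have [AG|] := pselect (forall x, A x -> exists y, G (x, y)).
  have [[x0 Ax0]|A0] := pselect (exists x, A x); last first.
    by left; rewrite (_ : A = set0) ?card_ge0 //; apply/seteqP; split=> x // Ax; case: A0; exists x.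
  have [y0 _] := AG _ Ax0.
  left; apply/(card_leE y0).
  exists (fun x => choose_or y0 [set y | G (x, y)]).
  have H x : A x -> G (x, choose_or y0 [set y | G (x, y)]).
    by move=> /AG [y Gy]; apply: (@choose_orP _ y0 [set y | G (x, y)]); exists y.
  split=> [x /H /GAB[]//|x y Ax Ay E].
  by have /= [_ ->] := Ginj _ _ (H _ Ax) (H _ Ay).
move=> /existsNP [x /not_implyP [Ax nGx]].
have BG y : B y -> exists x, G (x, y).
  move=> By; apply: contrapT => nGy.
  apply: (Gmax (G `|` [set (x, y)])).
    split; first by move=> p Gp; left.
    by move=> /(_ (x, y) (or_intror erefl)) Gxy; apply: nGx; exists y.
  split=> [p [/GAB//|->//]|p q [Gp|->] [Gq|->]//=]; first exact: Ginj.
    split=> E.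
      by case: nGx; exists p.2; rewrite -E -surjective_pairing.
    by case: nGy; exists p.1; rewrite -E -surjective_pairing.
  split=> E.
    by case: nGx; exists q.2; rewrite E -surjective_pairing.
  by case: nGy; exists q.1; rewrite E -surjective_pairing.
right; apply/(card_leE x).
exists (fun y => choose_or x [set x | G (x, y)]).
have H y : B y -> G (choose_or x [set x | G (x, y)], y).
  by move=> /BG [x' Gx']; apply: (@choose_orP _ x [set x | G (x, y)]); exists x'.
split=> [y /H /GAB[]//|y y' By By' E].
by have /= [-> ] := Ginj _ _ (H _ By) (H _ By').
Qed.

Definition pairing_on T (D : set T) (f : T -> T -> T) :=
  (forall x y, D x -> D y -> D (f x y)) /\
  (forall x y x' y', D x -> D y -> D x' -> D y' -> f x y = f x' y' -> x = x' /\ y = y').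

(** Zorn's lemma gives a maximal pairing f on an infinite D in B, starting from a
    countable D. If B \ D contained a copy g(D) of D, then f would extend to the union of
    D and g(D): this union embeds in D by tagging with f, so its new pairs can be coded
    in D by f and moved to g(D). Hence B \ D embeds in D, and tagging embeds B in D. *)
Lemma infinite_pairing T (B : set T) : infinite_set B -> exists f, pairing_on B f.
Proof.
move=> Binf.
have [x0 Bx0] : B !=set0 by exact: infinite_setN0.
have /(card_leE x0) [u [uB uinj]] : [set: nat] #<= B by apply/infiniteP.
have [c cinj] : exists c : nat -> nat -> nat, forall i j i' j', c i j = c i' j' -> i = i' /\ j = j'.
  exists (fun i j => pickle (i, j)) => i j i' j' /(pcan_inj pickleK) [-> ->] //.
pose Q (p : set T * (T -> T -> T)) := p.1 `<=` B /\ pairing_on p.1 p.2 /\ exists u : nat -> T,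
  (forall i, p.1 (u i)) /\ injective u.
pose v x := choose_or 0%N [set i | u i = x].
have vu i : v (u i) = i.
  have := @choose_orP _ 0%N [set j | u j = u i]; rewrite -/(v (u i)) /= => H.
  by apply: uinj => //; apply: H; exists i.
pose f0 x y := u (c (v x) (v y)).
have Q0 : Q (range u, f0).
  split=> [_ [i _ <-]|/=]; first exact: uB.
  split; last by exists u; split=> [i|i j]; [exists i|apply: uinj].
  split=> [x y _ _|_ _ _ _ [i _ <-] [j _ <-] [k _ <-] [l _ <-]]; first by exists (c (v x) (v y)).
  by rewrite /f0 !vu => /(uinj _ _ I I) /cinj [-> ->].
pose S := {p | Q p}.
pose le (p q : S) := (sval p).1 `<=` (sval q).1 /\
  forall x y, (sval p).1 x -> (sval p).1 y -> (sval p).2 x y = (sval q).2 x y.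
pose R (p q : S) := `[< le p q >].
have Rle p q : R p q <-> le p q by split=> /asboolP.
have [p|p q r /Rle[a1 b1] /Rle[a2 b2]|A Atot|[[D f] /= QD] Dmax] := @ZL_preorder _ (exist _ _ Q0) R.
- by apply/Rle; split.
- apply/Rle; split; first exact: subset_trans a1 a2.
  by move=> x y Dx Dy; rewrite b1 // b2 //; apply: a1.
- have [[p0 Ap0]|A0] := pselect (exists p, A p); last first.
    by exists (exist _ _ Q0) => s As; case: A0; exists s.
  pose D := \bigcup_(p in A) (sval p).1.
  pose p_ x y := choose_or p0 [set p | A p /\ (sval p).1 x /\ (sval p).1 y].
  have p_P x y : D x -> D y -> A (p_ x y) /\ (sval (p_ x y)).1 x /\ (sval (p_ x y)).1 y.
    move=> [p Ap px] [q Aq qy].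
    apply: (@choose_orP _ p0 [set p | A p /\ (sval p).1 x /\ (sval p).1 y]).
    have [/Rle[pq _]|/Rle[qp _]] := Atot _ _ Ap Aq.
      by exists q; do !split => //; apply: pq.
    by exists p; do !split => //; apply: qp.
  pose f x y := (sval (p_ x y)).2 x y.
  have fE p x y : A p -> (sval p).1 x -> (sval p).1 y -> f x y = (sval p).2 x y.
    move=> Ap px py.
    have [|| Aq [qx qy]] := p_P x y; try by exists p.
    by have [/Rle[pq E]|/Rle[qp E]] := Atot _ _ Ap Aq; rewrite /f ?E.
  have QDf : Q (D, f).
    split=> [x [p Ap /= px]|/=]; first by have [+ _] := svalP p; apply.
    split; last first.
      have [_ [_ [w [wD winj]]]] := svalP p0; exists w; split=> // i; exists p0 => //; exact: wD.
    have com x y x' y' : D x -> D y -> D x' -> D y' -> exists2 p, A p &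
        [/\ (sval p).1 x, (sval p).1 y, (sval p).1 x' & (sval p).1 y'].
      move=> Dx Dy Dx' Dy'.
      have [Ap [px py]] := p_P _ _ Dx Dy; have [Aq [qx qy]] := p_P _ _ Dx' Dy'.
      have [/Rle[pq _]|/Rle[qp _]] := Atot _ _ Ap Aq.
        by exists (p_ x' y') => //; split=> //; apply: pq.
      by exists (p_ x y) => //; split=> //; apply: qp.
    split=> [x y Dx Dy|x y x' y' Dx Dy Dx' Dy'].
      have [p Ap [px py _ _]] := com _ _ _ _ Dx Dy Dx Dy.
      rewrite (fE p) //; exists p => //; have [_ [[cl _] _]] := svalP p; exact: cl.
    have [p Ap [px py px' py']] := com _ _ _ _ Dx Dy Dx' Dy'.
    rewrite !(fE p) // => E; have [_ [[_ cl] _]] := svalP p; exact: cl E.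
  exists (exist _ _ QDf) => p Ap; apply/Rle; split=> /=; first by move=> x px; exists p.
  by move=> x y px py; rewrite (fE p).
have [/= DB [[fD finj] [w [wD winj]]]] := QD.
have [] := card_le_total (B `\` D) D; last first.
  case/(card_leE x0) => g [gB ginj].
  exfalso.
  pose D1 := D `|` g @` D.
  (* h embeds D1 in D, tagging the two pieces by w 0 and w 1. *)
  pose h x := if `[< D x >] then f (w 0%N) x else f (w 1%N) (choose_or x0 [set y | D y /\ g y = x]).
  have hg x : (g @` D) x ->
      D (choose_or x0 [set y | D y /\ g y = x]) /\
      g (choose_or x0 [set y | D y /\ g y = x]) = x.
    by case=> y Dy <-; apply: (@choose_orP _ x0 [set z | D z /\ g z = g y]); exists y.
  have hD x : D1 x -> D (h x).
    rewrite /h; case: asboolP => [Dx _|nDx [//|/hg[H1 H2]]]; apply: fD => //.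
  have hinj x y : D1 x -> D1 y -> h x = h y -> x = y.
    rewrite /h; case: asboolP => [Dx _|nDx [//|/hg[Hx1 Hx2]]];
     case: asboolP => [Dy _|nDy [//|/hg[Hy1 Hy2]]] /finj[]//.
    - by move=> /winj.
    - by move=> /winj.
    - by move=> _ E; rewrite -Hx2 -Hy2 E.
  pose f1 x y := if `[< D x >] && `[< D y >] then f x y else g (f (h x) (h y)).
  have QD1 : Q (D1, f1).
    split=> [x /= [/DB//|[y Dy <-]]|/=]; first by have [] := gB _ Dy.
    split; last by exists w; split=> // i; left.
    split=> [x y D1x D1y|x y x' y' D1x D1y D1x' D1y'].
      rewrite /f1; case: ifP => [/andP[/asboolP Dx /asboolP Dy]|_]; first by left; apply: fD.
      by right; exists (f (h x) (h y)) => //; apply: fD; apply: hD.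
    have gD z z' : D z -> D z' -> g z <> z'.
      by move=> Dz Dz' E; have [_] := gB _ Dz; rewrite E.
    have fhD u1 u2 : D1 u1 -> D1 u2 -> D (f (h u1) (h u2)).
      by move=> *; apply: fD; apply: hD.
    rewrite /f1; case: ifP => [/andP[/asboolP Dx /asboolP Dy]|_];
     case: ifP => [/andP[/asboolP Dx' /asboolP Dy']|_].
    - exact: finj.
    - by move=> E; case: (@gD (f (h x') (h y')) (f x y)) => //; [exact: fhD|exact: fD].
    - by move=> E; case: (@gD (f (h x) (h y)) (f x' y')) => //; [exact: fhD|exact: fD].
    - move=> /ginj H.
      have /finj[] := H (fhD _ _ D1x D1y) (fhD _ _ D1x' D1y'); try exact: hD.
      by move=> /hinj -> // /hinj ->.
  have /Rle[/= + _] : R (exist _ _ QD1) (exist _ _ QD).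
    apply: Dmax; apply/Rle; split=> /=; first by move=> x; left.
    move=> x y Dx Dy; rewrite /f1; case: asboolP => //; case: asboolP => //.
  move=> /(_ (g (w 0%N))) K; have [_] := gB _ (wD 0%N); apply; apply: K.
  by right; exists (w 0%N).
case/(card_leE x0) => g [gB ginj].
pose h x := if `[< D x >] then f (w 0%N) x else f (w 1%N) (g x).
have hD x : B x -> D (h x).
  rewrite /h; case: asboolP => [Dx _|nDx Bx]; apply: fD => //; exact: gB.
have hinj x y : B x -> B y -> h x = h y -> x = y.
  move=> Bx By; rewrite /h; case: asboolP => [Dx|nDx]; case: asboolP => [Dy|nDy] /finj H.
  - by have [] := H (wD _) Dx (wD _) Dy.
  - by have [] := H (wD _) Dx (wD _) (gB _ (conj By nDy)) => /winj.
  - by have [] := H (wD _) (gB _ (conj Bx nDx)) (wD _) Dy => /winj.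
  - have [] := H (wD _) (gB _ (conj Bx nDx)) (wD _) (gB _ (conj By nDy)) => _.
    by apply: ginj.
exists (fun x y => f (h x) (h y)); split.
  by move=> x y Bx By; apply: DB; apply: fD; apply: hD.
move=> x y x' y' Bx By Bx' By' /finj[]; try exact: hD.
by move=> /hinj -> // /hinj ->.
Qed.

(** Goedel numbering: the pairing on B codes a term by its head symbol and the codes of
    its arguments. *)
Lemma card_terms_over T (B : set T) : infinite_set B ->
  [set t | term_over B t] #<= B.
Proof.
move=> Binf; have [b0 Bb0] : B !=set0 by exact: infinite_setN0.
have [f [fB finj]] := infinite_pairing Binf.
have /(card_leE b0) [u [uB uinj]] : [set: nat] #<= B by apply/infiniteP.
pose code := fix code (t : term T) : T := match t with
  | Var i => f (u 0%N) (u i)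
  | Par b => f (u 1%N) b
  | Zero => f (u 2%N) (u 0%N)
  | One => f (u 3%N) (u 0%N)
  | Add t1 t2 => f (u 4%N) (f (code t1) (code t2))
  | Opp t => f (u 5%N) (code t)
  | Mul t1 t2 => f (u 6%N) (f (code t1) (code t2))
  | Der t => f (u 7%N) (code t)
  end.
have uD i : B (u i) by exact: uB.
have codeB t : term_over B t -> B (code t).
  elim: t => [i|b||| t1 h1 t2 h2|t h|t1 h1 t2 h2|t h] /= H; apply: (fB) => //.
  - by case: H => /h1 ? /h2 ?; apply: fB.
  - exact: h.
  - by case: H => /h1 ? /h2 ?; apply: fB.
  - exact: h.
have tag i j x y : B x -> B y -> f (u i) x = f (u j) y -> i = j /\ x = y.
  by move=> Bx By /finj[]// /uinj -> //.
apply/(card_leE b0); exists code; split=> [t|]; first exact: codeB.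
elim=> [i|b||| t1 h1 t2 h2|t h|t1 h1 t2 h2|t h];
  elim=> [i'|b'||| t1' _ t2' _|t' _|t1' _ t2' _|t' _] //= Ht Ht' /tag[]//;
  try (by [ | apply: codeB | apply: fB; case: Ht => *; apply: codeB
            | apply: fB; case: Ht' => *; apply: codeB]).
- by move=> _ /uinj ->.
- by move=> _ ->.
- case: Ht Ht' => a1 a2 [a3 a4] _ /finj[]; try exact: codeB.
  by move=> /h1 -> // /h2 ->.
- by move=> _ /h ->.
- case: Ht Ht' => a1 a2 [a3 a4] _ /finj[]; try exact: codeB.
  by move=> /h1 -> // /h2 ->.
- by move=> _ /h ->.
Qed.

Lemma sub_small (U : fieldType) (A B : set U) : A `<=` B -> small B -> small A.
Proof.
move=> AB; apply: contra => UA; apply: card_le_trans UA _; exact: subset_card_le.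
Qed.

(** All the parameter sets met below are contained in images of sets of terms, which is how
    their smallness is obtained. *)
Lemma small_image_terms (U : fieldType) (B : set U) (h : term U -> U) :
  infinite_set B -> small B -> small (h @` [set t | term_over B t]).
Proof.
move=> Binf; apply: contra => UA; apply: card_le_trans UA _.
exact: card_le_trans (card_image_le _ _) (card_terms_over Binf).
Qed.

(** * Subrings, polynomials over them, and derivations *)

Definition is_subring (R : comNzRingType) (S : set R) : Prop :=
  [/\ S 1, forall x y, S x -> S y -> S (x - y)
    & forall x y, S x -> S y -> S (x * y)].

Section Subring.
Variables (R : comNzRingType) (S : set R).
Hypothesis Sring : is_subring S.

Lemma subring1 : S 1. Proof. by case: Sring. Qed.
Lemma subringB x y : S x -> S y -> S (x - y). Proof. by case: Sring => _ + _; apply. Qed.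
Lemma subringM x y : S x -> S y -> S (x * y). Proof. by case: Sring => _ _; apply. Qed.
Lemma subring0 : S 0. Proof. by rewrite -(subrr 1); apply: subringB subring1 subring1. Qed.
Lemma subringN x : S x -> S (- x).
Proof. by rewrite -(sub0r x); apply: subringB subring0. Qed.
Lemma subringD x y : S x -> S y -> S (x + y).
Proof. by move=> Sx /subringN Sy; rewrite -(opprK y); apply: subringB. Qed.
Lemma subring_sum I (r : seq I) (P : pred I) (F : I -> R) :
  (forall i, P i -> S (F i)) -> S (\sum_(i <- r | P i) F i).
Proof. by move=> H; elim/big_ind: _ => //; [exact: subring0|exact: subringD]. Qed.
Lemma subring_prod I (r : seq I) (P : pred I) (F : I -> R) :
  (forall i, P i -> S (F i)) -> S (\prod_(i <- r | P i) F i).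
Proof. by move=> H; elim/big_ind: _ => //; [exact: subring1|exact: subringM]. Qed.
Lemma subringX x n : S x -> S (x ^+ n).
Proof. by move=> Sx; elim: n => [|n IH]; rewrite ?expr0 ?exprS; [exact: subring1|exact: subringM]. Qed.
Lemma subringMn x n : S x -> S (x *+ n).
Proof. by move=> Sx; elim: n => [|n IH]; rewrite ?mulr0n ?mulrS; [exact: subring0|exact: subringD]. Qed.

Definition polyIn (p : {poly R}) := forall i, S p`_i.

Lemma polyInB p q : polyIn p -> polyIn q -> polyIn (p - q).
Proof. by move=> Sp Sq i; rewrite coefB; apply: subringB. Qed.
Lemma polyInD p q : polyIn p -> polyIn q -> polyIn (p + q).
Proof. by move=> Sp Sq i; rewrite coefD; apply: subringD. Qed.
Lemma polyInM p q : polyIn p -> polyIn q -> polyIn (p * q).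
Proof. by move=> Sp Sq i; rewrite coefM; apply: subring_sum => j _; apply: subringM. Qed.
Lemma polyInC c : S c -> polyIn c%:P.
Proof. by move=> Sc i; rewrite coefC; case: ifP => // _; exact: subring0. Qed.
Lemma polyInXn n : polyIn 'X^n.
Proof. by move=> i; rewrite coefXn; case: eqP => _; [exact: subring1|exact: subring0]. Qed.
Lemma polyInZ c p : S c -> polyIn p -> polyIn (c *: p).
Proof. by move=> Sc Sp i; rewrite coefZ; apply: subringM. Qed.
Lemma polyIn_deriv p : polyIn p -> polyIn p^`().
Proof. by move=> Sp i; rewrite coef_deriv; apply: subringMn. Qed.
Lemma polyIn_comp p q : polyIn p -> polyIn q -> polyIn (p \Po q).
Proof.
move=> Sp Sq; rewrite comp_polyE => i; rewrite coef_sum; apply: subring_sum => j _.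
rewrite coefZ; apply: subringM => //; move: (nat_of_ord j) i; elim=> [|k IH] i.
  by rewrite expr0 coefC; case: eqP => _; [exact: subring1|exact: subring0].
by rewrite exprS; apply: polyInM.
Qed.

(** Pseudo-division instead of division keeps all coefficients in the subring S, and it
    needs no inverse of the leading coefficient, which may be a zero divisor in R. *)
Lemma pseudo_division f g : polyIn f -> f != 0 -> polyIn g ->
  exists k q r, [/\ polyIn q, polyIn r, (size r < size f)%N
    & lead_coef f ^+ k *: g = q * f + r].
Proof.
move=> Sf f0; move: {2}(size g) (leqnn (size g)) => m; elim: m g => [|m IH] g szg Sg.
  exists 0%N, 0, 0; move: szg; rewrite leqn0 size_poly_eq0 => /eqP ->.
  rewrite scaler0 mul0r addr0 size_poly0 lt0n size_poly_eq0; split=> // i; rewrite coef0; exact: subring0.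
have [szgf|szfg] := ltnP (size g) (size f).
  exists 0%N, 0, g; rewrite expr0 scale1r mul0r add0r; split=> // i; rewrite coef0; exact: subring0.
pose h := lead_coef g *: 'X^(size g - size f).
have Sh : polyIn h by apply: polyInZ (polyInXn _); apply: Sg.
pose g' := lead_coef f *: g - h * f.
have Sg' : polyIn g' by apply: polyInB (polyInM Sh Sf); apply: polyInZ => //; apply: Sf.
have szf : (0 < size f)%N by rewrite lt0n size_poly_eq0.
have szg' : (size g' <= m)%N.
  apply/leq_sizeP => j mj; rewrite coefB coefZ /h -scalerAl coefZ mulrC -commr_polyXn coefMXn.
  case: ltnP => jd.
    by exfalso; move: szg mj jd szf szfg; lia.
  have [E|ne] := eqVneq j (size g).-1.
    have -> : (j - (size g - size f) = (size f).-1)%N by move: szf szfg E; lia.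
    by rewrite E -!lead_coefE; apply/eqP; rewrite subr_eq0 mulrC.
  have lt : (size g <= j)%N by move: ne szg mj szf szfg; lia.
  rewrite (nth_default _ lt) (_ : f`_(_ - _) = 0); first by rewrite !(mulr0, mul0r) subrr.
  by rewrite nth_default // subnBA // addnC -addnBA // leq_addr.
have [k [q [r [Sq Sr szr E]]]] := IH g' szg' Sg'.
exists k.+1, (lead_coef f ^+ k *: h + q), r; split=> //.
  by apply: polyInD => //; apply: polyInZ => //; apply: subringX; apply: Sf.
rewrite exprSr -scalerA mulrDl -addrA -E /g' scalerBr -scalerAl addrC subrK //.
Qed.

(** The ring S[w]. *)
Definition adj (w : R) : set R := [set u | exists2 p, polyIn p & u = p.[w]].

Lemma polyIn_horner p w : polyIn p -> S w -> S p.[w].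
Proof.
by move=> Sp Sw; rewrite horner_coef; apply: subring_sum => i _; apply: subringM => //; apply: subringX.
Qed.

Lemma adj_subring w : is_subring (adj w).
Proof.
split=> [|_ _ [p Sp ->] [q Sq ->]|_ _ [p Sp ->] [q Sq ->]].
- by exists 1; rewrite ?hornerC //; apply: polyInC; exact: subring1.
- by exists (p - q); rewrite ?hornerE //; apply: polyInB.
- by exists (p * q); rewrite ?hornerE //; apply: polyInM.
Qed.

Lemma sub_adj w : S `<=` adj w.
Proof. by move=> c Sc; exists c%:P; rewrite ?hornerC //; apply: polyInC. Qed.

Lemma adj_gen w : adj w w.
Proof. by exists 'X; rewrite ?hornerX // -['X]expr1; exact: polyInXn. Qed.

Definition mpolyIn n (p : {mpoly R[n]}) := forall m, S p@_m.

Lemma mpolyInB n (p q : {mpoly R[n]}) : mpolyIn p -> mpolyIn q -> mpolyIn (p - q).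
Proof. by move=> Sp Sq i; rewrite mcoeffB; apply: subringB. Qed.
Lemma mpolyInM n (p q : {mpoly R[n]}) : mpolyIn p -> mpolyIn q -> mpolyIn (p * q).
Proof. by move=> Sp Sq i; rewrite mcoeffM; apply: subring_sum => j _; apply: subringM. Qed.
Lemma mpolyInC n c : S c -> mpolyIn (c%:MP : {mpoly R[n]}).
Proof.
move=> Sc i; rewrite mcoeffC; apply: subringM => //.
by case: eqP => _; [exact: subring1|exact: subring0].
Qed.
Lemma mpolyInX n m : mpolyIn ('X_[m] : {mpoly R[n]}).
Proof. by move=> i; rewrite mcoeffX; case: eqP => _; [exact: subring1|exact: subring0]. Qed.

(** The ring S[v_0, ..., v_(n-1)]. *)
Definition madj n (v : 'I_n -> R) : set R :=
  [set u | exists2 p : {mpoly R[n]}, mpolyIn p & u = p.@[v]].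

Lemma madj_subring n (v : 'I_n -> R) : is_subring (madj v).
Proof.
split=> [|_ _ [p Sp ->] [q Sq ->]|_ _ [p Sp ->] [q Sq ->]].
- by exists 1; rewrite ?meval1 //; apply: mpolyInC; exact: subring1.
- by exists (p - q); rewrite ?mevalB //; apply: mpolyInB.
- by exists (p * q); rewrite ?mevalM //; apply: mpolyInM.
Qed.

Lemma sub_madj n (v : 'I_n -> R) : S `<=` madj v.
Proof. by move=> c Sc; exists c%:MP; rewrite ?mevalC //; apply: mpolyInC. Qed.

Lemma madj_gen n (v : 'I_n -> R) i : madj v (v i).
Proof. by exists 'X_i; rewrite ?mevalXU //; exact: mpolyInX. Qed.

End Subring.

Lemma adj_min (R : comNzRingType) (S T : set R) w :
  is_subring T -> S `<=` T -> T w -> adj S w `<=` T.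
Proof. by move=> Tr ST Tw _ [p Sp ->]; apply: polyIn_horner => // i; apply: ST. Qed.

Lemma madj_min (R : comNzRingType) (S T : set R) n (v : 'I_n -> R) :
  is_subring T -> S `<=` T -> (forall i, T (v i)) -> madj S v `<=` T.
Proof.
move=> Tr ST Tv _ [p Sp ->]; rewrite mevalE; apply: subring_sum => // m _.
by apply: subringM => //; [apply: ST | apply: subring_prod => // i _; apply: subringX].
Qed.

Definition is_der (R : comNzRingType) (D : R -> R) : Prop :=
  (forall x y, D (x + y) = D x + D y) /\ (forall x y, D (x * y) = D x * y + x * D y).

Section Der.
Variables (R : comNzRingType) (D : R -> R).
Hypothesis Dder : is_der D.
Lemma derD x y : D (x + y) = D x + D y. Proof. by case: Dder. Qed.
Lemma derM x y : D (x * y) = D x * y + x * D y. Proof. by case: Dder. Qed.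
Lemma der0 : D 0 = 0.
Proof. by apply: (addrI (D 0)); rewrite -derD !addr0. Qed.
Lemma derN x : D (- x) = - D x.
Proof. by apply: (addrI (D x)); rewrite -derD !subrr der0. Qed.
Lemma derB x y : D (x - y) = D x - D y. Proof. by rewrite derD derN. Qed.
Lemma der1 : D 1 = 0.
Proof. by apply: (addrI (D 1)); rewrite addr0 -{3}[1]mulr1 derM mulr1 mul1r. Qed.
Lemma derMn x n : D (x *+ n) = D x *+ n.
Proof. by elim: n => [|n IH]; rewrite ?mulr0n ?der0 // !mulrS derD IH. Qed.

Lemma der_horner (p : {poly R}) w :
  D p.[w] = (map_poly D p).[w] + p^`().[w] * D w.
Proof.
elim/poly_ind: p => [|p c IH].
  by rewrite map_polyE /= !hornerC deriv0 horner0 mul0r addr0 der0 polyseq0 /= horner0.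
have -> : map_poly D (p * 'X + c%:P) = map_poly D p * 'X + (D c)%:P.
  apply/polyP => i; rewrite (coef_map_id0 _ _ der0) !coefD !coefMX !coefC derD.
  by rewrite (coef_map_id0 _ _ der0); case: eqP => _; rewrite der0.
rewrite derivD derivM derivX derivC !hornerE derD derM IH; ring.
Qed.
End Der.

(** * Partial isomorphisms as subrings of U * U *)

Section Pairs.
Variable U : fieldType.
Notation UU := (U * U)%type.
Implicit Types (S E : set UU) (u v w a b : UU).

(** A subring of U * U is the graph of an isomorphism between its two projections exactly
    when it is regular: two pairs with the same first coordinate differ by a pair whose
    first coordinate is 0. Working in the product ring lets one polynomial over S carry
    along both a polynomial and its image under the isomorphism. *)
Definition regular S := forall u, S u -> (u.1 = 0 <-> u.2 = 0).

Lemma regular_neq0 S u : regular S -> S u -> u != 0 -> u.1 != 0 /\ u.2 != 0.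
Proof.
move=> Sreg Su u0; have H := Sreg u Su.
have [E1|n1] := eqVneq u.1 0.
  by case/eqP: u0; rewrite [u]surjective_pairing E1 (H.1 E1).
by split=> //; apply: contra_neq n1 => /H.
Qed.

Lemma pairX1 u k : (u ^+ k).1 = u.1 ^+ k.
Proof. by elim: k => [|k IH]; rewrite ?expr0 // !exprS -IH. Qed.
Lemma pairX2 u k : (u ^+ k).2 = u.2 ^+ k.
Proof. by elim: k => [|k IH]; rewrite ?expr0 // !exprS -IH. Qed.

(** The extension of an isomorphism E to a simple algebraic extension generated by
    w = (w.1, w.2): f is a minimal polynomial of w.1 over the first projection of E, and
    w.2 is a root of the image of f. *)
Section AlgStep.
Variables (E : set UU) (f : {poly UU}) (w : UU).
Hypotheses (Ering : is_subring E) (Ereg : regular E) (Ef : polyIn E f) (f0 : f != 0).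
Hypothesis fmin : forall g, polyIn E g -> g != 0 -> (size g < size f)%N -> (g.[w]).1 != 0.

Lemma lead_neq0 g : polyIn E g -> g != 0 -> (lead_coef g).1 != 0 /\ (lead_coef g).2 != 0.
Proof. by move=> Eg g0; apply: regular_neq0 Ereg (Eg _) _; rewrite -/(lead_coef g) lead_coef_eq0. Qed.

(** Euclid's algorithm shows that g is invertible modulo f because f is minimal, and it
    runs over E, hence on both coordinates: if r is the pseudo-remainder of f by g, then
    a common root of f and g is a root of r, which is smaller. *)
Lemma min_neq0_snd g : f.[w] = 0 -> polyIn E g -> g != 0 -> (size g < size f)%N -> (g.[w]).2 != 0.
Proof.
move=> fw0; move: {2}(size g) (leqnn (size g)) => m; elim: m g => [|m IH] g szg Eg g0 szgf.
  by move: szg g0; rewrite leqn0 size_poly_eq0 => ->.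
have [c1 c2] := lead_neq0 Eg g0.
have [sz1|sz2] := leqP (size g) 1%N.
  by move: c2; rewrite (size1_polyC sz1) lead_coefC hornerC.
have [k [q [r [Eq Er szr Efg]]]] := pseudo_division Ering Eg g0 Ef.
have Ew : q.[w] * g.[w] + r.[w] = 0.
  by have := congr1 (horner^~ w) Efg; rewrite hornerZ fw0 mulr0 hornerD hornerM.
have [r0|r0] := eqVneq r 0.
  have gw1 := fmin Eg g0 szgf.
  move: Ew Efg; rewrite r0 hornerC !addr0 => /(congr1 fst) /= /eqP.
  rewrite mulf_eq0 (negPf gw1) orbF => /eqP qw1 Efg.
  have q0 : q != 0.
    apply/eqP => q0; move: Efg; rewrite q0 mul0r => /(congr1 (fun p : {poly UU} => p`_(size f).-1)).
    rewrite coefZ coef0 -lead_coefE => /(congr1 fst) /= /eqP.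
    by rewrite mulf_eq0 pairX1 expf_eq0 (negPf c1) andbF (negPf (lead_neq0 Ef f0).1).
  have szq : (size q < size f)%N.
    have szqg : size (q * g) = (size q + size g).-1.
      apply: size_proper_mul; apply/eqP => /(congr1 fst) /= /eqP.
      by rewrite mulf_eq0 (negPf c1) (negPf (lead_neq0 Eq q0).1).
    have := size_scale_leq (lead_coef g ^+ k) f; rewrite Efg szqg.
    by move: sz2; move: (size g) (size q) (size f) => x y z; lia.
  by have := fmin Eq q0 szq; rewrite qw1 eqxx.
have rw : (r.[w]).2 != 0.
  apply: IH => //; first by rewrite -ltnS; apply: leq_trans szr szg.
  exact: ltn_trans szr szgf.
apply: contra_neq rw => gw2.
by have /(congr1 snd) /= := Ew; rewrite gw2 mulr0 add0r.
Qed.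

(** Modulo f every g becomes a polynomial r smaller than f, which vanishes at a
    coordinate of w only if r = 0. *)
Lemma adj_regular_alg : f.[w] = 0 -> regular (adj E w).
Proof.
move=> fw0 _ [g Eg ->].
have [c1 c2] := lead_neq0 Ef f0.
have [k [q [r [Eq Er szr Efg]]]] := pseudo_division Ering Ef f0 Eg.
have Ew : lead_coef f ^+ k * g.[w] = r.[w].
  by have := congr1 (horner^~ w) Efg; rewrite hornerZ hornerD hornerM fw0 mulr0 add0r.
have H1 : (g.[w]).1 = 0 <-> (r.[w]).1 = 0.
  rewrite -Ew /=; split=> [->|/eqP]; rewrite ?mulr0 // mulf_eq0 pairX1 expf_eq0.
  by rewrite (negPf c1) andbF => /eqP.
have H2 : (g.[w]).2 = 0 <-> (r.[w]).2 = 0.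
  rewrite -Ew /=; split=> [->|/eqP]; rewrite ?mulr0 // mulf_eq0 pairX2 expf_eq0.
  by rewrite (negPf c2) andbF => /eqP.
rewrite H1 H2; have [->|r0] := eqVneq r 0; first by rewrite hornerC.
have n1 := fmin Er r0 szr; have n2 := min_neq0_snd fw0 Er r0 szr.
by split=> E'; [move: n1|move: n2]; rewrite E' eqxx.
Qed.
End AlgStep.

(** The localization of S at its regular elements. *)
Definition frac S : set UU :=
  [set u | exists a b, [/\ S a, S b, b.1 != 0 & u * b = a]].

Section Frac.
Variable S : set UU.
Hypotheses (Sring : is_subring S) (Sreg : regular S).

Lemma regular_snd b : S b -> b.1 != 0 -> b.2 != 0.
Proof. by move=> Sb; apply: contra_neq => /(Sreg Sb). Qed.

Lemma sub_frac : S `<=` frac S.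
Proof.
by move=> u Su; exists u, 1; rewrite mulr1 oner_eq0; split=> //; exact: subring1 Sring.
Qed.

Lemma frac_subring : is_subring (frac S).
Proof.
split=> [|u v [a [b [Sa Sb b0 E]]] [a' [b' [Sa' Sb' b0' E']]]
         |u v [a [b [Sa Sb b0 E]]] [a' [b' [Sa' Sb' b0' E']]]].
- by apply: sub_frac; exact: subring1 Sring.
- exists (a * b' - a' * b), (b * b'); split; last by rewrite -E -E'; ring.
  + by apply: subringB => //; apply: subringM.
  + exact: subringM.
  + by rewrite /= mulf_neq0.
- exists (a * a'), (b * b'); split; try exact: subringM.
  + by rewrite /= mulf_neq0.
  + by rewrite -E -E'; ring.
Qed.

Lemma frac_regular : regular (frac S).
Proof.
move=> u [a [b [Sa Sb b1 E]]]; have b2 := regular_snd Sb b1.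
rewrite -E in Sa; have [/= H1 H2] := Sreg Sa.
split=> [u1|u2]; apply/eqP.
  by have := H1; rewrite u1 mul0r => /(_ erefl)/eqP; rewrite mulf_eq0 (negPf b2) orbF.
by have := H2; rewrite u2 mul0r => /(_ erefl)/eqP; rewrite mulf_eq0 (negPf b1) orbF.
Qed.

Lemma frac_div u a b : frac S a -> frac S b -> b.1 != 0 -> u * b = a -> frac S u.
Proof.
move=> [x [y [Sx Sy y0 E1]]] [x' [y' [Sx' Sy' y0' E2]]] b0 E.
exists (x * y'), (x' * y); split; try exact: subringM.
  by rewrite -E2 /= !mulf_neq0.
by rewrite -E1 -E2 -E; ring.
Qed.
End Frac.
End Pairs.

(** * Multivariate polynomials and differentially closed fields *)

Section MPoly.
Variables (R : comNzRingType) (n : nat).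
Local Notation widn := (widen_ord (leqnSn n)).

Lemma meval_mwiden (p : {mpoly R[n]}) (v : 'I_n.+1 -> R) :
  (mwiden p).@[v] = p.@[v \o widn].
Proof.
rewrite [in LHS](mpolyE p) (raddf_sum (@mwiden n R)) (raddf_sum (meval v)) mevalE.
apply: eq_bigr => m _; rewrite /= mwidenZ mwidenX mevalZ mevalX big_ord_recr /= mnmwiden_ordmax expr0 mulr1.
by congr (_ * _); apply: eq_bigr => i _; rewrite mnmwiden_widen.
Qed.

Lemma meval_mmulti (F : {poly {mpoly R[n]}}) (v : 'I_n.+1 -> R) :
  (mmulti F).@[v] = (map_poly (meval (v \o widn)) F).[v ord_max].
Proof.
rewrite /mmulti raddf_sum /= (@horner_coef_wide _ (size F)) ?size_poly //.
apply: eq_bigr => i _; rewrite mevalM meval_mwiden coef_map /= rmorphXn /=.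
by rewrite mevalXU.
Qed.

Lemma meval_muni (p : {mpoly R[n.+1]}) (v : 'I_n.+1 -> R) :
  p.@[v] = (map_poly (meval (v \o widn)) (muni p)).[v ord_max].
Proof.
rewrite muniE raddf_sum /= horner_sum mevalE; apply: eq_bigr => m _.
rewrite map_polyZ /= map_polyXn hornerZ hornerXn mevalZ mevalX big_ord_recr /= mulrA.
by congr (_ * _ * _); apply: eq_bigr => i _; rewrite mnmE.
Qed.

Lemma coef_muni (p : {mpoly R[n.+1]}) (m : 'X_{1..n.+1}) :
  ((muni p)`_(m ord_max))@_[multinom m (widn i) | i < n] = p@_m.
Proof.
rewrite muniE coef_sum raddf_sum /= [in RHS](mpolyE p) raddf_sum /=.
apply: eq_bigr => k _; rewrite coefZ coefXn mcoeffZ mcoeffX.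
have -> : (k == m) =
    ([multinom k (widn i) | i < n] == [multinom m (widn i) | i < n]) && (m ord_max == k ord_max).
  apply/eqP/andP => [->//|[/eqP /mnmP E /eqP Em]]; apply/mnmP => i.
  have [lt|ge] := ltnP i n.
    by have := E (Ordinal lt); rewrite !mnmE; rewrite (_ : widn _ = i) //; apply: val_inj.
  by rewrite (_ : i = ord_max) //; apply: val_inj => /=; apply/eqP; rewrite eqn_leq ge -ltnS ltn_ord.
rewrite -scalerAl mcoeffZ; case: (m ord_max == k ord_max).
  by rewrite mulr1 mcoeffX andbT.
by rewrite mulr0 mcoeff0 andbF.
Qed.

Lemma coef_muniE (p : {mpoly R[n.+1]}) k (m : 'X_{1..n}) :
  exists m', ((muni p)`_k)@_m = p@_m'.
Proof.
exists (mnmwiden m + U_(ord_max) *+ k)%MM; rewrite -coef_muni.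
have -> : (mnmwiden m + U_(ord_max) *+ k)%MM ord_max = k.
  by rewrite mnmDE mnmwiden_ordmax mulmnE mnm1E eqxx mul1n.
congr (_@_ _); apply/mnmP => i; rewrite mnmE mnmDE mnmwiden_widen mulmnE mnm1E.
by case: eqP => [/(congr1 val)/= E|_]; rewrite ?addn0 //; have := ltn_ord i; rewrite -E ltnn.
Qed.

Lemma muni_neq0 (p : {mpoly R[n.+1]}) : p != 0 -> muni p != 0.
Proof.
apply: contra_neq => E; apply/mpolyP => m.
by rewrite -coef_muni E coef0 !mcoeff0.
Qed.
End MPoly.

Section Char0.
Variable U : fieldType.
Hypothesis char0 : [pchar U] =i pred0.

Lemma char0_neq0 k : (0 < k)%N -> k%:R != 0 :> U.
Proof. by move/pcharf0P: char0 => ->; case: k. Qed.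

Lemma poly_vanish (q : {poly U}) : (forall s, q.[s] = 0) -> q = 0.
Proof.
move=> q0; apply/eqP; apply: contraT => qn0.
have := @max_poly_roots _ q [seq i%:R | i <- iota 0 (size q)] qn0.
rewrite size_map size_iota ltnn => -> //.
  by apply/allP => x _; rewrite /root q0.
rewrite map_inj_in_uniq ?iota_uniq // => i j _ _.
wlog ij : i j / (i <= j)%N => [H|/eqP].
  by case/orP: (leq_total i j) => ? E; [|symmetry]; apply: H.
rewrite eq_sym -subr_eq0 -natrB //; move/pcharf0P: char0 => ->.
by rewrite subn_eq0 => ji; apply/eqP; rewrite eqn_leq ij.
Qed.
End Char0.

Section Blum.
Variables (U : fieldType) (d : U -> U).
Hypotheses (char0 : [pchar U] =i pred0) (dc : differentially_closed d).

(** A polynomial that does not involve the last variable cannot detect its value; the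
    contrapositive is how polynomials are shown to have a given order. *)
Lemma not_has_order n (f : {mpoly U[n.+1]}) v v' : ~ has_order f ->
  (forall i : 'I_n, v (widen_ord (leqnSn n) i) = v' (widen_ord (leqnSn n) i)) ->
  f.@[v] = f.@[v'].
Proof.
move=> nof vv'; rewrite !mevalE !big_seq; apply: eq_bigr => m mf.
congr (_ * _); rewrite !big_ord_recr /=; congr (_ * _).
  by apply: eq_bigr => i _; rewrite vv'.
suff -> : m ord_max = 0%N by rewrite !expr0.
by apply: contrapT => /eqP m0; apply: nof; exists m.
Qed.

Lemma diff_nonvanishing n (G : {mpoly U[n]}) : G != 0 -> exists x, diff_eval d G x != 0.
Proof.
move=> G0; have [|x [_ ?]] := @dc n 'X_ord_max G _ G0; last by exists x.
by exists U_(ord_max)%MM; rewrite ?mnm1E ?eqxx // msuppX mem_seq1.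
Qed.

(** The closedness hypothesis, for a polynomial F in X^(n) whose coefficients are
    polynomials in X, ..., X^(n-1): since the leading coefficient of F does not vanish
    identically, F takes different values when only X^(n) varies. *)
Lemma blum n (F : {poly {mpoly U[n]}}) (G : {mpoly U[n]}) : (1 < size F)%N -> G != 0 ->
  exists x, (map_poly (meval (fun i : 'I_n => iter i d x)) F).[iter n d x] = 0 /\
    diff_eval d G x != 0.
Proof.
move=> szF G0; have [|x [x0 Gx]] := @dc n (mmulti F) G _ G0; last first.
  by exists x; split=> //; move: x0; rewrite /diff_eval meval_mmulti.
apply: contrapT => nof.
have F0 : lead_coef F != 0 by rewrite lead_coef_eq0 -size_poly_eq0; case: (size F) szF.
have [x lx] := diff_nonvanishing F0.
pose v s (i : 'I_n.+1) := if (i < n)%N then iter i d x else s.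
pose q := map_poly (meval (fun i : 'I_n => iter i d x)) F.
have qE s : (mmulti F).@[v s] = q.[s].
  rewrite meval_mmulti {2}/v /= ltnn; congr (_ .[_]); apply: eq_map_poly => p /=.
  by apply: meval_eq => i; rewrite /v /= ltn_ord.
have szq : (1 < size q)%N by rewrite size_map_poly_id0.
have q0 : q - q.[0]%:P = 0.
  apply: poly_vanish => // s; rewrite !hornerE -!qE; apply/eqP; rewrite subr_eq0; apply/eqP.
  by apply: not_has_order => // i; rewrite /v /= ltn_ord.
move: szq; rewrite -[q](subrK (q.[0])%:P) q0 add0r.
by rewrite ltnNge size_polyC; case: (_ != _).
Qed.

Lemma diff_widen n N (h : {mpoly U[n]}) : (n <= N)%N -> h != 0 ->
  exists2 h' : {mpoly U[N]}, h' != 0 & forall x, diff_eval d h' x = diff_eval d h x.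
Proof.
elim: N => [|N IH]; first by rewrite leqn0 => /eqP n0 h0; subst n; exists h.
rewrite leq_eqVlt => /orP[/eqP nN h0|/IH{}IH /IH[h' h'0 E]]; first by subst n; exists h.
exists (mwiden h').
  by apply: contra_neq h'0; rewrite -(mwiden0 N U) => /inj_mwiden.
by move=> x; rewrite -E /diff_eval meval_mwiden.
Qed.
End Blum.

(** * Terms, their values, and saturation *)

Section Terms.
Variables (U : fieldType) (d : U -> U).
Implicit Types (t x : term U) (e : seq U) (A : set U).

Definition tsum (s : seq (term U)) := foldr (@Add U) (Zero U) s.
Definition tprod (s : seq (term U)) := foldr (@Mul U) (One U) s.
Definition texp t n := iter n (Mul t) (One U).
Definition tder t n := iter n (@Der U) t.

Lemma eval_tsum e I (r : seq I) F : eval d e (tsum [seq F i | i <- r]) = \sum_(i <- r) eval d e (F i).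
Proof. by elim: r => [|i r IH]; rewrite ?big_nil ?big_cons //= IH. Qed.
Lemma eval_tprod e I (r : seq I) F : eval d e (tprod [seq F i | i <- r]) = \prod_(i <- r) eval d e (F i).
Proof. by elim: r => [|i r IH]; rewrite ?big_nil ?big_cons //= IH. Qed.
Lemma eval_texp e t n : eval d e (texp t n) = eval d e t ^+ n.
Proof. by elim: n => [|n IH]; rewrite ?expr0 // exprS -IH. Qed.
Lemma eval_tder e t n : eval d e (tder t n) = iter n d (eval d e t).
Proof. by elim: n => //= n ->. Qed.

Lemma over_tsum A I (r : seq I) F : (forall i, term_over A (F i)) -> term_over A (tsum [seq F i | i <- r]).
Proof. by move=> H; elim: r => //= i r IH; split. Qed.
Lemma over_tprod A I (r : seq I) F : (forall i, term_over A (F i)) -> term_over A (tprod [seq F i | i <- r]).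
Proof. by move=> H; elim: r => //= i r IH; split. Qed.
Lemma over_texp A t n : term_over A t -> term_over A (texp t n).
Proof. by move=> H; elim: n => //= n IH; split. Qed.
Lemma over_tder A t n : term_over A t -> term_over A (tder t n).
Proof. by move=> H; elim: n. Qed.

(** The terms below express the value at t of a differential polynomial of order less than
    n, of one of order n written as a polynomial in X^(n), and of an ordinary polynomial. *)
Definition tmpoly n (p : {mpoly U[n]}) t :=
  tsum [seq Mul (Par p@_m) (tprod [seq texp (tder t i) (m i) | i : 'I_n <- enum 'I_n]) | m <- msupp p].

Definition tpolym n (F : {poly {mpoly U[n]}}) t :=
  tsum [seq Mul (tmpoly F`_i t) (texp (tder t n) i) | i <- iota 0 (size F)].

Definition tpoly (p : {poly U}) t :=
  tsum [seq Mul (Par p`_i) (texp t i) | i <- iota 0 (size p)].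

Lemma eval_tmpoly e n (p : {mpoly U[n]}) t : eval d e (tmpoly p t) = diff_eval d p (eval d e t).
Proof.
rewrite /diff_eval mevalE /tmpoly eval_tsum; apply: eq_bigr => m _ /=.
rewrite eval_tprod big_enum /=; congr (_ * _); apply: eq_bigr => i _.
by rewrite eval_texp eval_tder.
Qed.

Lemma eval_tpolym e n (F : {poly {mpoly U[n]}}) t : eval d e (tpolym F t) =
  (map_poly (meval (fun i : 'I_n => iter i d (eval d e t))) F).[iter n d (eval d e t)].
Proof.
rewrite /tpolym eval_tsum (@horner_coef_wide _ (size F)) ?size_poly //.
rewrite -(big_mkord predT (fun i => _`_i * _ ^+ i)) /index_iota subn0.
apply: eq_bigr => i _; rewrite coef_map /= eval_texp eval_tder eval_tmpoly //.
Qed.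

Lemma eval_tpoly e (p : {poly U}) t : eval d e (tpoly p t) = p.[eval d e t].
Proof.
rewrite /tpoly eval_tsum horner_coef.
rewrite -(big_mkord predT (fun i => _`_i * _ ^+ i)) /index_iota subn0.
by apply: eq_bigr => i _; rewrite /= eval_texp.
Qed.

Lemma over_tmpoly A n (p : {mpoly U[n]}) t : mpolyIn A p -> term_over A t -> term_over A (tmpoly p t).
Proof.
move=> Ap At; apply: over_tsum => m; split; first exact: Ap.
by apply: over_tprod => i; apply: over_texp; apply: over_tder.
Qed.

Lemma over_tpolym A n (F : {poly {mpoly U[n]}}) t : (forall i, mpolyIn A F`_i) -> term_over A t ->
  term_over A (tpolym F t).
Proof.
move=> Ap At; apply: over_tsum => i; split; first exact: over_tmpoly.
by apply: over_texp; apply: over_tder.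
Qed.

Lemma over_tpoly A (p : {poly U}) t : polyIn A p -> term_over A t -> term_over A (tpoly p t).
Proof. by move=> Ap At; apply: over_tsum => i; split; [exact: Ap|exact: over_texp]. Qed.
End Terms.

Section Values.
Variables (U : fieldType) (d : U -> U).
Hypothesis dder : derivation d.
Notation UU := (U * U)%type.

Lemma d_is_der : is_der d. Proof. exact: dder. Qed.

Definition dpair (w : UU) : UU := (d w.1, d w.2).

Lemma dpair_der : is_der dpair.
Proof. by case: dder => dD dM; split=> x y; rewrite /dpair /= ?dD ?dM. Qed.

(** The differential ring generated by B and e. *)
Definition values (B : set U) (e : seq U) : set U :=
  [set u | exists2 t, term_over B t & u = eval d e t].

Lemma values_subring B e : is_subring (values B e).
Proof.
split=> [|_ _ [t Bt ->] [s Bs ->]|_ _ [t Bt ->] [s Bs ->]].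
- by exists (One U).
- by exists (Add t (Opp s)).
- by exists (Mul t s).
Qed.

Lemma values_der B e u : values B e u -> values B e (d u).
Proof. by case=> t Bt ->; exists (Der t). Qed.

Lemma sub_values B e : B `<=` values B e.
Proof. by move=> b Bb; exists (Par b). Qed.

Lemma values_env B e i : values B e (nth 0 e i).
Proof. by exists (Var _ i). Qed.

Lemma values_min (B T : set U) e : is_subring T -> (forall u, T u -> T (d u)) ->
  B `<=` T -> (forall i, T (nth 0 e i)) -> values B e `<=` T.
Proof.
move=> Tr Td BT Te _ [t Bt ->]; elim: t Bt => [i|b||| t1 h1 t2 h2|t h|t1 h1 t2 h2|t h] //=.
- by move=> Bb; apply: BT.
- by move=> _; exact: subring0 Tr.
- by move=> _; exact: subring1 Tr.
- by case=> /h1 H1 /h2 H2; exact (subringD Tr H1 H2).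
- by move=> /h H; exact (subringN Tr H).
- by case=> /h1 H1 /h2 H2; exact (subringM Tr H1 H2).
- by move=> /h ?; exact: Td.
Qed.

Lemma values_small B e : infinite_set B -> small B -> small (values B e).
Proof.
move=> Binf Bs; apply: sub_small (small_image_terms (eval d e) Binf Bs).
by move=> _ [t Bt ->]; exists t.
Qed.

Definition pair_values (B : set U) (e1 e2 : seq U) : set UU :=
  [set w | exists2 t, term_over B t & w = (eval d e1 t, eval d e2 t)].

Lemma pair_values_subring B e1 e2 : is_subring (pair_values B e1 e2).
Proof.
split=> [|_ _ [t Bt ->] [s Bs ->]|_ _ [t Bt ->] [s Bs ->]].
- by exists (One U).
- by exists (Add t (Opp s)).
- by exists (Mul t s).
Qed.

Lemma pair_values_der B e1 e2 w : pair_values B e1 e2 w -> pair_values B e1 e2 (dpair w).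
Proof. by case=> t Bt ->; exists (Der t). Qed.

Lemma pair_values_min B (T : set UU) e1 e2 : is_subring T -> (forall u, T u -> T (dpair u)) ->
  (forall b, B b -> T (b, b)) -> (forall i, T (nth 0 e1 i, nth 0 e2 i)) ->
  pair_values B e1 e2 `<=` T.
Proof.
move=> Tr Td BT Te _ [t Bt ->]; elim: t Bt => [i|b||| t1 h1 t2 h2|t h|t1 h1 t2 h2|t h] //=.
- by move=> Bb; apply: BT.
- by move=> _; exact: subring0 Tr.
- by move=> _; exact: subring1 Tr.
- by case=> /h1 H1 /h2 H2; exact (subringD Tr H1 H2).
- by move=> /h H; exact (subringN Tr H).
- by case=> /h1 H1 /h2 H2; exact (subringM Tr H1 H2).
- by move=> /h H; exact: Td H.
Qed.

(** e1 and e2 have the same quantifier-free type over B. *)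
Definition qf_equiv B e1 e2 := regular (pair_values B e1 e2).

Lemma qf_equivE B e1 e2 t : qf_equiv B e1 e2 -> term_over B t ->
  eval d e1 t = 0 <-> eval d e2 t = 0.
Proof. by move=> q Bt; apply: (q (_, _)); exists t. Qed.

Lemma qf_equiv_sym B e1 e2 : qf_equiv B e1 e2 -> qf_equiv B e2 e1.
Proof. by move=> q _ [t Bt ->] /=; rewrite (qf_equivE q). Qed.
End Values.

Section Saturation.
Variables (U : fieldType) (d : U -> U).
Hypothesis sat : saturated d.

Lemma finite_range (I X : Type) (P : I -> X) (q : set X) : finite_set q -> q `<=` range P ->
  exists s : seq I, forall f, q f -> exists2 i, List.In i s & f = P i.
Proof.
case=> n; rewrite card_eq_le => /andP[/(card_leE 0%N)[F [FI Finj]] _] qP.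
suff [s Hs] : exists s : seq I, forall f, q f -> (F f < n)%N -> exists2 i, List.In i s & f = P i.
  by exists s => f qf; apply: Hs => //; exact: FI.
elim: n {FI} => [|n [s Hs]]; first by exists [::].
have [[f [qf Ff]]|nf] := pselect (exists f, q f /\ F f = n).
  have [i _ Pi] := qP _ qf; exists (i :: s) => g qg; rewrite ltnS leq_eqVlt => /orP[/eqP E|lt].
    by exists i; [left|rewrite Pi; apply: Finj; rewrite // E Ff].
  by have [j ? ?] := Hs _ qg lt; exists j => //; right.
exists s => g qg; rewrite ltnS leq_eqVlt => /orP[/eqP E|lt]; last exact: Hs.
by case: nf; exists g.
Qed.

(** Saturation, with the type given as an indexed family of formulas. *)
Lemma realize_family (A : set U) (I : Type) (P : I -> formula U) :
  small A -> (forall i, formula_over A (P i)) ->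
  (forall s : seq I, exists x, forall i, List.In i s -> holds d [:: x] (P i)) ->
  exists x, forall i, holds d [:: x] (P i).
Proof.
move=> As PA fin.
have [||x xP] := @sat A (range P) As; last by exists x => i; apply: xP; exists i.
  by move=> _ [i _ <-].
move=> q qfin qP; have [s Hs] := finite_range qfin qP.
have [x Hx] := fin s; exists x => f /Hs [i si ->]; exact: Hx.
Qed.
End Saturation.

(** * Quantifier elimination *)

Section RMorphEval.
Variables (R S : comNzRingType) (f : {rmorphism R -> S}).

Lemma rmorph_meval n (p : {mpoly R[n]}) (v : 'I_n -> R) :
  f p.@[v] = (map_mpoly f p).@[f \o v].
Proof.
rewrite [in RHS](mpolyE p) (raddf_sum (map_mpoly f)) (raddf_sum (meval _)) mevalE raddf_sum.
apply: eq_bigr => m _; rewrite /= map_mpolyZ map_mpolyX mevalZ mevalX rmorphM rmorph_prod.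
by congr (_ * _); apply: eq_bigr => i _; rewrite rmorphXn.
Qed.

Lemma rmorph_hmeval n (F : {poly {mpoly R[n]}}) (v : 'I_n -> R) w :
  f (map_poly (meval v) F).[w] =
  (map_poly (meval (f \o v)) (map_poly (map_mpoly f) F)).[f w].
Proof.
rewrite -horner_map -!map_poly_comp; congr (_.[_]); apply: eq_map_poly => p.
by rewrite /= rmorph_meval.
Qed.
End RMorphEval.

(** To check that the derivatives of a ring stay in a ring T, this reduces to generators. *)
Lemma der_subring (R : comNzRingType) (D : R -> R) (S T : set R) : is_der D ->
  is_subring S -> is_subring T -> S `<=` T -> is_subring [set u | S u /\ T (D u)].
Proof.
move=> Dd Sr Tr ST; split=> [|u v [Su Tu] [Sv Tv]|u v [Su Tu] [Sv Tv]].
- by rewrite /= der1 //; split; [exact: subring1 Sr|exact: subring0 Tr].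
- by rewrite /= derB //; split; apply: subringB.
- rewrite /= derM //; split; first exact: subringM.
  by apply: subringD => //; apply: subringM => //; apply: ST.
Qed.

(** One step of the back-and-forth argument: the isomorphism rho between the differential
    rings of e1 and e2 extends to the one generated by x. Throughout, W y n and w y n pair the
    derivatives of x with those of the candidate y; m1 and m2 read a polynomial over rho
    in the first and in the second coordinate. *)
Section Forth.
Variables (U : fieldType) (d : U -> U).
Hypotheses (char0 : [pchar U] =i pred0) (dder : derivation d)
  (dc : differentially_closed d) (sat : saturated d).
Variable B : set U.
Hypotheses (Binf : infinite_set B) (Bs : small B).
Variables (e1 e2 : seq U) (x : U).
Hypothesis e12 : qf_equiv d B e1 e2.
Notation UU := (U * U)%type.

Let rho : set UU := pair_values d B e1 e2.
Let rho_ring : is_subring rho. Proof. exact: pair_values_subring. Qed.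
Let Dder : is_der (dpair d). Proof. exact: dpair_der. Qed.

Let W y n : 'I_n -> UU := fun i => (iter i d x, iter i d y).
Let w y n : UU := (iter n d x, iter n d y).
Arguments W : clear implicits.

Let m1 n (P : {mpoly UU[n]}) : {mpoly U[n]} := map_mpoly fst P.
Let m2 n (P : {mpoly UU[n]}) : {mpoly U[n]} := map_mpoly snd P.

(* dep n: the derivatives x, ..., x^(n-1) are algebraically dependent over the first
   projection of rho; indep y n: those of y are independent over the second one. *)
Let dep n := exists P : {mpoly UU[n]}, [/\ mpolyIn rho P, P != 0 & diff_eval d (m1 P) x = 0].
Let indep y n := forall P : {mpoly UU[n]}, mpolyIn rho P -> P != 0 -> diff_eval d (m2 P) y != 0.

Let W_fst y n (P : {mpoly UU[n]}) : (P.@[W y n]).1 = diff_eval d (m1 P) x.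
Proof. exact: (rmorph_meval fst). Qed.
Let W_snd y n (P : {mpoly UU[n]}) : (P.@[W y n]).2 = diff_eval d (m2 P) y.
Proof. exact: (rmorph_meval snd). Qed.

Lemma m2_neq0 n (P : {mpoly UU[n]}) : mpolyIn rho P -> P != 0 -> m2 P != 0.
Proof.
move=> rP; apply: contra_neq => E; apply/mpolyP => m; rewrite mcoeff0.
apply/eqP; apply: contraT => n0; have [_ /eqP[]] := regular_neq0 e12 (rP m) n0.
by rewrite -(mcoeff_map_mpoly snd) -/(m2 P) E mcoeff0.
Qed.

Lemma m2_over n (P : {mpoly UU[n]}) : mpolyIn rho P -> mpolyIn (values d B e2) (m2 P).
Proof.
move=> rP m; rewrite (mcoeff_map_mpoly snd); case: (rP m) => t Bt -> /=; by exists t.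
Qed.

Lemma W_neq0 y n (P : {mpoly UU[n]}) : ~ dep n -> indep y n -> mpolyIn rho P -> P != 0 ->
  (P.@[W y n]).1 != 0 /\ (P.@[W y n]).2 != 0.
Proof.
move=> nd iy rP P0; rewrite W_fst W_snd; split; last exact: iy.
by apply/eqP => E; apply: nd; exists P.
Qed.

Lemma madj_regular y n : ~ dep n -> indep y n -> regular (madj rho (W y n)).
Proof.
move=> nd iy _ [P rP ->]; have [->|P0] := eqVneq P 0; first by rewrite meval0.
by have [n1 n2] := W_neq0 nd iy rP P0; split=> /eqP; rewrite ?(negPf n1) ?(negPf n2).
Qed.

(** It is enough to find some regular differential ring that contains rho and (x, y). *)
Lemma qf_equiv_cons y (T : set UU) : is_subring T -> (forall u, T u -> T (dpair d u)) ->
  rho `<=` T -> T (x, y) -> regular T -> qf_equiv d B (x :: e1) (y :: e2).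
Proof.
move=> Tr Td rT Txy Treg u /(pair_values_min Tr Td) Tu; apply: Treg; apply: Tu.
  by move=> b Bb; apply: rT; exists (Par b).
by case=> [|i] //=; apply: rT; exists (Var _ i).
Qed.

Lemma indep_dwitness (I : Type) (n : I -> nat) (P : forall i, {mpoly UU[n i]}) (s : seq I) :
  (forall i, mpolyIn rho (P i)) -> (forall i, P i != 0) ->
  exists N (h : {mpoly U[N]}), h != 0 /\
    forall y, diff_eval d h y != 0 -> forall i, List.In i s -> diff_eval d (m2 (P i)) y != 0.
Proof.
move=> rP P0; elim: s => [|i s [N [h [h0 IH]]]].
  by exists 0%N, 1; split; first exact: oner_neq0.
have [h1 h10 E1] := diff_widen d (leq_maxl N (n i)) h0.
have [h2 h20 E2] := diff_widen d (leq_maxr N (n i)) (m2_neq0 (rP i) (P0 i)).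
exists (maxn N (n i)), (h1 * h2); split; first by rewrite mulf_neq0.
move=> y; rewrite {1}/diff_eval mevalM mulf_eq0 negb_or => /andP[n1 n2] j /= [<-|sj].
  by rewrite -E2.
by apply: IH => //; rewrite -E1.
Qed.

(** When x is differentially transcendental, it is matched with a y that is so too, which
    exists by saturation and the nonvanishing of nonzero differential polynomials. *)
Lemma forth_transcendental : (forall n, ~ dep n) -> exists y, qf_equiv d B (x :: e1) (y :: e2).
Proof.
move=> nd.
pose I := {n : nat & {P : {mpoly UU[n]} | mpolyIn rho P /\ P != 0}}.
pose P (i : I) : {mpoly UU[tag i]} := sval (tagged i).
have rP i : mpolyIn rho (P i) by case: (svalP (tagged i)).
have P0 i : P i != 0 by case: (svalP (tagged i)).
have [|||y Hy] := @realize_family _ _ sat (values d B e2) I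
  (fun i => Not (Eq (tmpoly (m2 (P i)) (Var _ 0)) (Zero _))).
- exact: values_small.
- by move=> i; split=> //; apply: over_tmpoly => //; exact: m2_over.
- move=> s; have [N [h [h0 Hh]]] := indep_dwitness s rP P0.
  have [y hy] := diff_nonvanishing dc h0; exists y => i si /=; rewrite eval_tmpoly /=.
  by apply/eqP; apply: Hh.
have iy n : indep y n.
  move=> Q rQ Q0; have /= := Hy (existT _ n (exist _ Q (conj rQ Q0))).
  by rewrite eval_tmpoly => /eqP.
exists y; pose T := [set u | exists n, madj rho (W y n) u].
have mono n m : (n <= m)%N -> madj rho (W y n) `<=` madj rho (W y m).
  move=> nm; apply: madj_min; [exact: madj_subring|exact: sub_madj|] => i.
  exact: (madj_gen rho_ring (W y m) (widen_ord nm i)).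
have Tcom u v : T u -> T v -> exists n, madj rho (W y n) u /\ madj rho (W y n) v.
  move=> [n nu] [m mv]; exists (maxn n m).
  by split; [apply: mono nu; exact: leq_maxl|apply: mono mv; exact: leq_maxr].
apply: (@qf_equiv_cons y T).
- split=> [|u v Tu Tv|u v Tu Tv].
  + by exists 0%N; exact: (subring1 (madj_subring rho_ring (W y 0))).
  + by have [n [nu nv]] := Tcom u v Tu Tv; exists n; exact: (subringB (madj_subring rho_ring (W y n)) nu nv).
  + by have [n [nu nv]] := Tcom u v Tu Tv; exists n; exact: (subringM (madj_subring rho_ring (W y n)) nu nv).
- move=> u [n nu]; exists n.+1.
  have [] // : [set u | madj rho (W y n.+1) u /\ madj rho (W y n.+1) (dpair d u)] u.
  apply: (madj_min _ _ _ nu).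
  + by apply: der_subring => //; exact: madj_subring.
  + by move=> c rc; split; apply: sub_madj => //; apply: pair_values_der.
  + move=> i; split; first exact: (madj_gen rho_ring (W y n.+1) (widen_ord (leqnSn n) i)).
    exact: (madj_gen rho_ring (W y n.+1) (lift ord0 i)).
- by move=> c rc; exists 0%N; apply: sub_madj.
- by exists 1%N; exact: (madj_gen rho_ring (W y 1) ord0).
- by move=> u [n nu]; exact: (madj_regular (nd n) (iy n) nu).
Qed.

(* kill F is the value of F(X, ..., X^(n)) at x, in the first coordinate. *)
Let kill n (F : {poly {mpoly UU[n]}}) :=
  (map_poly (meval (fun i : 'I_n => iter i d x)) (map_poly (@m1 n) F)).[iter n d x].
Let polym_over n (F : {poly {mpoly UU[n]}}) := forall i, mpolyIn rho F`_i.

Let W_kill y n F : ((map_poly (meval (W y n)) F).[w y n]).1 = kill F.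
Proof. exact: (rmorph_hmeval fst). Qed.

(** Here x, ..., x^(n-1) are independent and x^(n) has the minimal polynomial F. Then E is
    purely transcendental on both sides, adjoining w y n is an algebraic step, and the
    quotients are closed under derivation because the derivative of a root of f is
    a quotient by the value of the derivative of f. *)
Section Assemble.
Variables (n : nat) (y : U) (F : {poly {mpoly UU[n]}}).
Hypotheses (nd : ~ dep n) (iy : indep y n).
Hypotheses (rF : polym_over F) (szF : (1 < size F)%N).
Hypothesis Fmin : forall G : {poly {mpoly UU[n]}},
  polym_over G -> G != 0 -> kill G = 0 -> (size F <= size G)%N.
Let f := map_poly (meval (W y n)) F.
Hypothesis fw : f.[w y n] = 0.

Let E := madj rho (W y n).
Let E' := adj E (w y n).
Let T := frac E'.

Let Ering : is_subring E. Proof. exact: madj_subring. Qed.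
Let Ering' : is_subring E'. Proof. exact: adj_subring. Qed.
Let Ereg : regular E. Proof. exact: madj_regular. Qed.
Let fE : polyIn E f. Proof. by move=> i; rewrite coef_map /=; exists F`_i. Qed.

Let F0 : F != 0. Proof. by rewrite -size_poly_gt0; apply: leq_trans szF. Qed.

Let szf : size f = size F.
Proof.
have lF : lead_coef F != 0 by rewrite lead_coef_eq0.
rewrite size_map_poly_id0 //; have [n1 _] := W_neq0 nd iy (rF (size F).-1) lF.
by apply: contra_neq n1 => ->.
Qed.

Let f0 : f != 0. Proof. by rewrite -size_poly_gt0 szf size_poly_gt0. Qed.

(** The minimality of F passes to E, whose elements are values of polynomials over rho. *)
Lemma lift_min g : polyIn E g -> g != 0 -> (size g < size f)%N -> (g.[w y n]).1 != 0.
Proof.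
move=> gE g0; rewrite szf => lt; apply/eqP => gw.
have /choice[G HG] : forall i, exists P : {mpoly UU[n]}, mpolyIn rho P /\ g`_i = P.@[W y n].
  by move=> i; have [P rP ->] := gE i; exists P.
pose H := \poly_(i < size g) G i.
have HgE : map_poly (meval (W y n)) H = g.
  apply/polyP => i; rewrite coef_map /= coef_poly; case: ltnP => [_|ge].
    by case: (HG i).
  by rewrite meval0 nth_default.
have rH : polym_over H.
  move=> i; rewrite coef_poly; case: ifP => _; first by case: (HG i).
  by move=> m; rewrite mcoeff0; exact: subring0 rho_ring.
have H0 : H != 0 by apply: contra_neq g0 => H0; rewrite -HgE H0 rmorph0.
have kH : kill H = 0 by rewrite -(W_kill y) HgE.
by have := leq_trans lt (Fmin rH H0 kH); rewrite ltnNge size_poly.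
Qed.

Let Ereg' : regular E'. Proof. exact: adj_regular_alg lift_min fw. Qed.
Let Tring : is_subring T. Proof. exact: frac_subring. Qed.
Let subE : E `<=` E'. Proof. exact: sub_adj. Qed.
Let subT : E' `<=` T. Proof. exact: sub_frac. Qed.

Let derE u : E u -> E' (dpair d u).
Proof.
move=> Eu; have [] // : [set u | E' u /\ E' (dpair d u)] u.
apply: (madj_min _ _ _ Eu).
- exact: der_subring.
- by move=> c rc; split; apply: subE; apply: sub_madj => //; apply: pair_values_der.
- move=> i; split; first by apply: subE; exact: madj_gen.
  have [lt|ge] := ltnP i.+1 n; first by apply: subE; exact: (madj_gen rho_ring (W y n) (Ordinal lt)).
  have -> : dpair d (W y n i) = w y n; last exact: adj_gen.
  have ni : i.+1 = n by apply/eqP; rewrite eqn_leq ge ltn_ord.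
  by rewrite /w -[in RHS]ni.
Qed.

Let derw : T (dpair d (w y n)).
Proof.
have szf' : (size f^`() < size f)%N by exact: lt_size_deriv.
have fE' : polyIn E f^`() by exact: polyIn_deriv.
have f'0 : f^`() != 0.
  apply/eqP => /(congr1 (fun p : {poly UU} => p`_(size f).-2)).
  rewrite coef_deriv coef0 => /(congr1 fst) /eqP.
  have -> : ((size f).-2.+1 = (size f).-1)%N by rewrite szf; case: (size F) szF => [|[]].
  rewrite -lead_coefE raddfMn /= -mulr_natr mulf_eq0.
  have [/negPf-> _] := lead_neq0 Ereg fE f0.
  by rewrite (negPf (char0_neq0 char0 _)) // szf; case: (size F) szF => [|[]].
apply: (frac_div Ering' (a := - (map_poly (dpair d) f).[w y n]) (b := f^`().[w y n])).
- apply: subT; apply: subringN => //; apply: polyIn_horner => //; last exact: adj_gen.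
  by move=> i; rewrite (coef_map_id0 _ _ (der0 Dder)); apply: derE.
- by apply: subT; apply: polyIn_horner => //; [move=> i; apply: subE|exact: adj_gen].
- exact: lift_min.
- have := der_horner Dder f (w y n); rewrite fw (der0 Dder) => /esym/eqP.
  by rewrite addr_eq0 => /eqP ->; rewrite opprK mulrC.
Qed.

Let derE' u : E' u -> T (dpair d u).
Proof.
move=> Eu; have [] // : [set u | T u /\ T (dpair d u)] u.
apply: (adj_min _ _ _ Eu); first exact: der_subring.
- by move=> c Ec; split; apply: subT; [exact: subE|exact: derE].
- by split; [apply: subT; exact: adj_gen|exact: derw].
Qed.

Lemma assemble : qf_equiv d B (x :: e1) (y :: e2).
Proof.
apply: (@qf_equiv_cons y T) => //.
- move=> u Tu; have [a [b [Ea Eb b0 ub]]] := Tu.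
  apply: (frac_div Ering' (a := dpair d a - u * dpair d b) (b := b)) => //.
  + by apply: subringB => //; [exact: derE'|apply: subringM => //; exact: derE'].
  + exact: subT.
  + by rewrite -ub derM // addrK.
- by move=> c rc; apply: subT; apply: subE; apply: sub_madj.
- apply: subT; case: (posnP n) => n0.
    by have -> : (x, y) = w y n; [rewrite /w n0|exact: adj_gen].
  by apply: subE; exact: (madj_gen rho_ring (W y n) (Ordinal n0)).
- exact: frac_regular.
Qed.
End Assemble.

Lemma not_dep0 : ~ dep 0.
Proof.
case=> P [rP P0]; rewrite -(W_fst x) => P1.
have PE : P = (P@_0)%:MP.
  apply/mpolyP => m; rewrite mcoeffC; have -> : m = 0%MM by apply/mnmP; case.
  by rewrite eqxx mulr1.
have c0 : P@_0 != 0 by apply: contra_neq P0 => E; rewrite PE E.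
have [/eqP[]] := regular_neq0 e12 (rP 0%MM) c0.
by move: P1; rewrite PE mevalC mcoeffC eqxx mulr1.
Qed.

(** Choose F of minimal degree in X^(n) with F(x) = 0; saturation and the closedness of U
    give y with y, ..., y^(n-1) independent and F(y) = 0 in the second coordinate. *)
Lemma forth_algebraic n : ~ dep n -> dep n.+1 -> exists y, qf_equiv d B (x :: e1) (y :: e2).
Proof.
move=> nd [P [rP P0 Px]].
pose Q k := `[< exists F : {poly {mpoly UU[n]}}, [/\ polym_over F, F != 0, kill F = 0 & size F = k] >].
have exQ : exists k, Q k.
  exists (size (muni P)); apply/asboolP; exists (muni P); split=> //.
  - by move=> i m; have [m' ->] := coef_muniE P i m; apply: rP.
  - exact: muni_neq0.
  - by rewrite -(W_kill x) -[RHS]Px -(W_fst x) meval_muni.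
have [F [rF F0 Fx szF]] : exists F : {poly {mpoly UU[n]}}, [/\ polym_over F, F != 0, kill F = 0 &
    forall G : {poly {mpoly UU[n]}}, polym_over G -> G != 0 -> kill G = 0 -> (size F <= size G)%N].
  have [k /asboolP[F [rF F0 Fx szF]] kmin] := ex_minnP exQ; exists F; split=> // G rG G0 Gx.
  by rewrite szF; apply: kmin; apply/asboolP; exists G.
have szF1 : (1 < size F)%N.
  rewrite ltnNge; apply/negP => sz1; apply: nd; exists F`_0; split=> //.
    by apply: contra_neq F0 => E; rewrite (size1_polyC sz1) E.
  have : kill (F`_0)%:P = 0 by rewrite -size1_polyC.
  by rewrite /kill (map_polyC (map_mpoly fst)) map_polyC /= hornerC.
pose I := option {P : {mpoly UU[n]} | mpolyIn rho P /\ P != 0}.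
pose F2 := map_poly (@m2 n) F.
pose phi (i : I) := if i is Some P then Not (Eq (tmpoly (m2 (sval P)) (Var _ 0)) (Zero _))
  else Eq (tpolym F2 (Var _ 0)) (Zero _).
have [|[[P' [rP' P0']]|]|s|y Hy] := @realize_family _ _ sat (values d B e2) I phi.
- exact: values_small.
- by split=> //; apply: over_tmpoly => //; exact: m2_over.
- by split=> //; apply: over_tpolym => // i; rewrite (coef_map (map_mpoly snd)); exact: (m2_over (rF i)).
- have [h [h0 Hh]] : exists h : {mpoly U[n]}, h != 0 /\ forall y, diff_eval d h y != 0 ->
      forall P, List.In (Some P) s -> diff_eval d (m2 (sval P)) y != 0.
    elim: s => [|[P' |] s [h [h0 IH]]].
    - by exists 1; split; first exact: oner_neq0.
    - have [rP' P0'] := svalP P'; exists (m2 (sval P') * h); split; first by rewrite mulf_neq0 // m2_neq0.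
      move=> y; rewrite {1}/diff_eval mevalM mulf_eq0 negb_or => /andP[n1 n2] R /= [[<-]//|].
      exact: IH.
    - by exists h; split=> // y yh R /= [//|]; exact: IH.
  have szF2 : (1 < size F2)%N.
    by rewrite size_map_poly_id0 //; apply: m2_neq0; [exact: rF|rewrite lead_coef_eq0].
  have [y [Fy hy]] := blum char0 dc szF2 h0.
  exists y => -[P'|] si /=; last by rewrite eval_tpolym.
  by rewrite eval_tmpoly; apply/eqP; apply: Hh.
exists y; apply: (@assemble n y F) => //.
  move=> P' rP' P0'; have := Hy (Some (exist _ P' (conj rP' P0'))).
  by rewrite /= eval_tmpoly => /eqP.
rewrite [LHS]surjective_pairing W_kill Fx; congr (_, _).
by rewrite (rmorph_hmeval snd); have := Hy None; rewrite /= eval_tpolym.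
Qed.

Lemma forth : exists y, qf_equiv d B (x :: e1) (y :: e2).
Proof.
have [[n dn]|nd] := pselect (exists n, dep n); last first.
  by apply: forth_transcendental => n dn; apply: nd; exists n.
suff [n' [ndn' dn']] : exists n', ~ dep n' /\ dep n'.+1 by exact: forth_algebraic dn'.
elim: n dn => [/not_dep0//|n IH dn].
by have [/IH//|ndn] := pselect (dep n); exists n.
Qed.
End Forth.

Section Elementary.
Variables (U : fieldType) (d : U -> U).
Hypotheses (char0 : [pchar U] =i pred0) (dder : derivation d)
  (dc : differentially_closed d) (sat : saturated d).
Variable B : set U.
Hypotheses (Binf : infinite_set B) (Bs : small B).

(** Quantifier elimination, by back-and-forth: only the existential quantifier needs an
    argument, and it is the lemma forth and its mirror image. *)
Theorem qf_equiv_elementary f e1 e2 : qf_equiv d B e1 e2 -> formula_over B f ->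
  holds d e1 f <-> holds d e2 f.
Proof.
elim: f e1 e2 => [t1 t2|f IH|f1 IH1 f2 IH2|f IH] e1 e2 q /=.
- case=> B1 B2; have := qf_equivE (t := Add t1 (Opp t2)) q (conj B1 B2) => /= H.
  split=> E; apply/eqP; rewrite -subr_eq0; apply/eqP; apply/H; rewrite E subrr //.
- by move=> Bf; have H := IH _ _ q Bf; split=> n /H.
- by case=> B1 B2; rewrite (IH1 _ _ q B1) (IH2 _ _ q B2).
- move=> Bf; split=> [[x fx]|[y fy]].
    have [y qy] := forth char0 dder dc sat Binf Bs x q.
    by exists y; apply/(IH _ _ qy Bf).
  have [x qx] := forth char0 dder dc sat Binf Bs y (qf_equiv_sym q).
  by exists x; apply/(IH _ _ qx Bf).
Qed.
End Elementary.

(** * Generic solutions of first order equations *)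

Section Algebraic.
Variable U : fieldType.
Implicit Types (A : set U) (x : U) (p : {poly U}).

Lemma polyIn_polyOver A p : is_subring A -> polyIn A p <-> p \is a polyOver (mem A).
Proof.
move=> Ar; split=> [Ap|/(all_nthP 0) Ap i].
  by apply/(all_nthP 0) => i _; apply: mem_set; exact: Ap.
have [lt|ge] := ltnP i (size p); first exact: set_mem (Ap i lt).
by rewrite nth_default //; exact: subring0 Ar.
Qed.

Lemma alg_closureP A x : is_subring A ->
  alg_closure A x <-> exists p, [/\ polyIn A p, p != 0 & p.[x] = 0].
Proof.
move=> Ar; split=> [[p [Ap p0 /rootP px]]|[p [Ap p0 px]]]; exists p; split=> //.
- exact/polyIn_polyOver.
- exact/polyIn_polyOver.
- exact/rootP.
Qed.

Lemma not_alg_eq0 A x p : is_subring A -> ~ alg_closure A x -> polyIn A p -> p.[x] = 0 -> p = 0.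
Proof.
move=> Ar nx Ap px; apply/eqP; apply: contra_notT nx => p0.
by apply/alg_closureP => //; exists p.
Qed.

Lemma alg_closure_sub A A' : A `<=` A' -> alg_closure A `<=` alg_closure A'.
Proof.
move=> AA' x [p [Ap p0 px]]; exists p; split=> //.
apply/(all_nthP 0) => i /(all_nthP 0 Ap); exact: (mem_set \o (@AA' _) \o set_mem).
Qed.

Lemma sub_alg_closure A x : is_subring A -> A x -> alg_closure A x.
Proof.
move=> Ar Ax; apply/alg_closureP => //; exists ('X - x%:P); split.
- by apply: polyInB => //; [rewrite -['X]expr1; exact: polyInXn|exact: polyInC].
- by rewrite polyXsubC_eq0.
- by rewrite !hornerE subrr.
Qed.

Lemma injective_nonroot (h : nat -> U) p : injective h -> p != 0 -> exists k, p.[h k] != 0.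
Proof.
move=> hinj p0; apply: contrapT => H; suff : false by [].
have := @max_poly_roots _ p [seq h i | i <- iota 0 (size p)] p0.
rewrite size_map size_iota ltnn => -> //.
  apply/allP => _ /mapP[i _ ->]; apply/rootP/eqP; apply: contraT => n0.
  by case: H; exists i.
by rewrite map_inj_uniq ?iota_uniq.
Qed.
End Algebraic.

Section Step.
Variables (U : fieldType) (d : U -> U).
Hypothesis dder : derivation d.
Notation UU := (U * U)%type.

(** Transcendental solutions x1 and x2 of corresponding equations x' = g(x) can be matched
    with each other: p(x1, x2) with p over rho form a ring that the equation makes
    closed under derivation. *)
Lemma qf_equiv_step B e1 e2 (g : {poly UU}) x1 x2 : qf_equiv d B e1 e2 ->
  polyIn (pair_values d B e1 e2) g -> g.[(x1, x2)] = (d x1, d x2) ->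
  ~ alg_closure (values d B e1) x1 -> ~ alg_closure (values d B e2) x2 ->
  qf_equiv d B (x1 :: e1) (x2 :: e2).
Proof.
move=> q rg gx n1 n2; set rho := pair_values d B e1 e2 in rg.
have rring : is_subring rho by exact: pair_values_subring.
have Dder := dpair_der dder.
apply: (qf_equiv_cons (T := adj rho (x1, x2))).
- exact: adj_subring.
- move=> _ [p rp ->]; rewrite (der_horner Dder).
  exists (map_poly (dpair d) p + p^`() * g); last by rewrite hornerD hornerM gx.
  apply: polyInD => //; last by apply: polyInM => //; exact: polyIn_deriv.
  by move=> i; rewrite (coef_map_id0 _ _ (der0 Dder)); exact: (pair_values_der (rp i)).
- exact: sub_adj.
- exact: adj_gen.
- move=> _ [p rp ->].
  have h1 : (p.[(x1, x2)]).1 = (map_poly fst p).[x1] by rewrite -(horner_map fst).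
  have h2 : (p.[(x1, x2)]).2 = (map_poly snd p).[x2] by rewrite -(horner_map snd).
  have v1 i : values d B e1 (p`_i).1 by case: (rp i) => t Bt -> /=; exists t.
  have v2 i : values d B e2 (p`_i).2 by case: (rp i) => t Bt -> /=; exists t.
  rewrite h1 h2; split=> E.
    have p1 : map_poly fst p = 0.
      by apply: (not_alg_eq0 _ n1) => //; [exact: values_subring|move=> i; rewrite (coef_map fst); exact: v1].
    suff -> : map_poly snd p = 0 by rewrite horner0.
    apply/polyP => i; rewrite (coef_map snd) coef0; apply/(q _ (rp i)).
    by rewrite -(coef_map fst) p1 coef0.
  have p2 : map_poly snd p = 0.
    by apply: (not_alg_eq0 _ n2) => //; [exact: values_subring|move=> i; rewrite (coef_map snd); exact: v2].
  suff -> : map_poly fst p = 0 by rewrite horner0.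
  apply/polyP => i; rewrite (coef_map fst) coef0; apply/(q _ (rp i)).
  by rewrite -(coef_map snd) p2 coef0.
Qed.

Lemma qf_equiv_refl B e : qf_equiv d B e e.
Proof. by move=> _ [t _ ->]. Qed.

Lemma qf_equiv_generic B (g : {poly U}) x1 x2 : polyIn (values d B [::]) g ->
  d x1 = g.[x1] -> d x2 = g.[x2] ->
  ~ alg_closure (values d B [::]) x1 -> ~ alg_closure (values d B [::]) x2 ->
  qf_equiv d B [:: x1] [:: x2].
Proof.
move=> Bg E1 E2 n1 n2; pose D (c : U) : UU := (c, c).
have D0 : D 0 = 0 by [].
apply: (qf_equiv_step (g := map_poly D g)) => //; first exact: qf_equiv_refl.
  by move=> i; rewrite (coef_map_id0 _ _ D0); case: (Bg i) => t Bt ->; exists t.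
have Dm : additive D by [].
rewrite E1 E2 [LHS]surjective_pairing; congr (_, _).
  rewrite -[LHS](horner_map fst) /=; congr (_.[_]); apply/polyP => i.
  by rewrite (coef_map fst) (coef_map_id0 _ _ D0).
rewrite -[LHS](horner_map snd) /=; congr (_.[_]); apply/polyP => i.
by rewrite (coef_map snd) (coef_map_id0 _ _ D0).
Qed.
End Step.

Section Generic.
Variables (U : fieldType) (d : U -> U).
Hypotheses (char0 : [pchar U] =i pred0) (dc : differentially_closed d) (sat : saturated d).

(* p as a differential polynomial of order 0. *)
Let pm (p : {poly U}) : {mpoly U[1]} := (map_poly (@mpolyC 1 U) p).['X_ord0].

Let pmE p x : diff_eval d (pm p) x = p.[x].
Proof.
rewrite /diff_eval /pm -(horner_map (meval _)) /= mevalXU -map_poly_comp /=; congr (_.[_]).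
by apply/polyP => i; rewrite coef_map_id0 /= mevalC.
Qed.

Lemma blum1 (g p : {poly U}) : p != 0 -> exists x, d x = g.[x] /\ p.[x] != 0.
Proof.
move=> p0; have pm0 : pm p != 0.
  apply: contra_neq p0 => E; apply: (poly_vanish char0) => x.
  by rewrite -pmE E /diff_eval meval0.
have [|x [+ xp]] := blum char0 dc (F := 'X - (pm g)%:P) _ pm0; first by rewrite size_XsubC.
rewrite rmorphB /= map_polyX map_polyC /= !hornerE -/(diff_eval d (pm g) x) pmE => /eqP.
by rewrite subr_eq0 => /eqP E; exists x; split=> //; rewrite -pmE.
Qed.

(** Finitely many polynomials are avoided by avoiding their product. *)
Lemma realize_nonalgebraic A f : is_subring A -> small A -> formula_over A f ->
  (forall p, polyIn A p -> p != 0 -> exists x, holds d [:: x] f /\ p.[x] != 0) ->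
  exists x, holds d [:: x] f /\ ~ alg_closure A x.
Proof.
move=> Ar As Af H.
pose I := option {p : {poly U} | polyIn A p /\ p != 0}.
pose phi (i : I) := if i is Some p then Not (Eq (tpoly (sval p) (Var _ 0)) (Zero _)) else f.
have [[[p [Ap p0]]|]|s|x Hx] := @realize_family _ _ sat A I phi As.
- by split=> //; apply: over_tpoly.
- by [].
- have [p [Ap p0 Hp]] : exists p : {poly U}, [/\ polyIn A p, p != 0 & forall x, p.[x] != 0 ->
      forall r, List.In (Some r) s -> (sval r).[x] != 0].
    elim: s => [|[r|] s [p [Ap p0 IH]]].
    - exists 1; split=> //; [by apply: polyInC => //; exact: subring1 Ar|exact: oner_neq0].
    - have [Ar' r0] := svalP r; exists (sval r * p); split; [exact: polyInM|by rewrite mulf_neq0|].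
      by move=> x; rewrite hornerM mulf_eq0 negb_or => /andP[n1 n2] r' /= [[<-]//|]; exact: IH.
    - by exists p; split=> // x px r /= [//|]; exact: IH.
  have [x [fx px]] := H p Ap p0; exists x => -[r|] si //=.
  by rewrite eval_tpoly; apply/eqP; exact: Hp.
exists x; split; first exact: (Hx None).
case/alg_closureP => // p [Ap p0 px]; have := Hx (Some (exist _ p (conj Ap p0))).
by rewrite /= eval_tpoly.
Qed.

Lemma generic_solution A (g : {poly U}) : is_subring A -> small A -> polyIn A g ->
  exists x, d x = g.[x] /\ ~ alg_closure A x.
Proof.
move=> Ar As Ag.
have [||x] := realize_nonalgebraic (f := Eq (Der (Var _ 0)) (tpoly g (Var _ 0))) Ar As.
- by split=> //; exact: over_tpoly.
- move=> p Ap p0; have [x [dx px]] := blum1 g p0.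
  by exists x; split=> //=; rewrite eval_tpoly.
- by rewrite /= eval_tpoly; exists x.
Qed.
End Generic.

(** * Strong minimality and stationarity *)

Section FormulaParameters.
Variable U : fieldType.

Lemma term_over_sub (A A' : set U) t : A `<=` A' -> term_over A t -> term_over A' t.
Proof.
move=> AA'; elim: t => [i|b||| t1 h1 t2 h2|t h|t1 h1 t2 h2|t h] //=; first exact: AA'.
  by case=> /h1 ? /h2.
by case=> /h1 ? /h2.
Qed.

Lemma formula_over_sub (A A' : set U) f : A `<=` A' -> formula_over A f -> formula_over A' f.
Proof.
move=> AA'; elim: f => [t1 t2|f h|f1 h1 f2 h2|f h] //=.
  by case=> /(term_over_sub AA') ? /(term_over_sub AA').
by case=> /h1 ? /h2.
Qed.

Fixpoint term_params (t : term U) : seq U := match t with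
  | Par a => [:: a]
  | Add t1 t2 | Mul t1 t2 => term_params t1 ++ term_params t2
  | Opp t1 | Der t1 => term_params t1
  | _ => [::]
  end.

Fixpoint params (f : formula U) : seq U := match f with
  | Eq t1 t2 => term_params t1 ++ term_params t2
  | Not f1 | Ex f1 => params f1
  | And f1 f2 => params f1 ++ params f2
  end.

Lemma sub_cat_l (s1 s2 : seq U) : [set` s1] `<=` [set` s1 ++ s2].
Proof. by move=> x /=; rewrite mem_cat => ->. Qed.
Lemma sub_cat_r (s1 s2 : seq U) : [set` s2] `<=` [set` s1 ++ s2].
Proof. by move=> x /=; rewrite mem_cat => ->; rewrite orbT. Qed.

Lemma term_over_params t : term_over [set` term_params t] t.
Proof.
elim: t => [i|b||| t1 h1 t2 h2|t h|t1 h1 t2 h2|t h] //=; first by rewrite mem_head.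
  by split; [exact: term_over_sub (@sub_cat_l _ _) h1|exact: term_over_sub (@sub_cat_r _ _) h2].
by split; [exact: term_over_sub (@sub_cat_l _ _) h1|exact: term_over_sub (@sub_cat_r _ _) h2].
Qed.

Lemma formula_over_params f : formula_over [set` params f] f.
Proof.
elim: f => [t1 t2|f h|f1 h1 f2 h2|f h] //=.
  split; [exact: term_over_sub (@sub_cat_l _ _) (term_over_params t1)|].
  exact: term_over_sub (@sub_cat_r _ _) (term_over_params t2).
by split; [exact: formula_over_sub (@sub_cat_l _ _) h1|exact: formula_over_sub (@sub_cat_r _ _) h2].
Qed.

(** Elements of values B [::] are values of terms whose variables are read as 0; closing
    these terms makes them usable in formulas that have a free variable. *)
Fixpoint tclose (t : term U) : term U := match t with
  | Var _ => Zero U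
  | Par a => Par a
  | Zero => Zero U
  | One => One U
  | Add t1 t2 => Add (tclose t1) (tclose t2)
  | Opp t1 => Opp (tclose t1)
  | Mul t1 t2 => Mul (tclose t1) (tclose t2)
  | Der t1 => Der (tclose t1)
  end.

Lemma eval_tclose d e t : eval d e (tclose t) = eval d [::] t.
Proof. by elim: t => //= [i|t1 -> t2 ->|t ->|t1 -> t2 ->|t ->] //; rewrite nth_nil. Qed.

Lemma tclose_over A t : term_over A t -> term_over A (tclose t).
Proof.
by elim: t => //= [t1 h1 t2 h2|t1 h1 t2 h2] [/h1 ? /h2 ?].
Qed.

Lemma complete_tp (d : U -> U) (A : set U) x : complete_type d A (tp d A x).
Proof.
split=> [f []//|q _ qp|f Af]; first by exists x => f /qp[].
by have [fx|nfx] := pselect (holds d [:: x] f); [left|right].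
Qed.

Lemma complete_type_tp (d : U -> U) (A : set U) p x :
  complete_type d A p -> realizes d x p -> p = tp d A x.
Proof.
move=> [pA _ pc] xp; apply/seteqP; split=> f; first by move=> pf; split; [exact: pA|exact: xp].
by case=> Af fx; case: (pc f Af) => // /xp.
Qed.
End FormulaParameters.

(** The ordinals 0 and 1: every b i is 0, that is, indexed by an empty type. *)
Definition low (c : ordinal_tree) : Prop :=
  let: osup T b := c in forall i : T, let: osup V _ := b i in V -> False.

Section Rank.
Variables (U : fieldType) (d : U -> U).

Lemma morley_consistent c f : morley_ge d c f -> exists x, holds d [:: x] f.
Proof. by case: c => T b []. Qed.

Lemma morley_low c f : low c -> (exists h : nat -> U, injective h /\ forall k, holds d [:: h k] f) ->
  morley_ge d c f.
Proof.
case: c => T b lc [h [hinj hf]]; split; first by exists (h 0%N).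
move=> i; exists (fun n => Eq (Var _ 0) (Par (h n))); split=> [n x /= ->//|m n x mn /= -> /hinj //|n].
by move: (lc i); case: (b i) => V b' nS; split; [exists (h n)|move=> s; case: (nS s)].
Qed.

Lemma infinite_of_morley (T : Type) (b : T -> ordinal_tree) f : T -> morley_ge d (osup b) f ->
  exists h : nat -> U, injective h /\ forall k, holds d [:: h k] f.
Proof.
move=> i [_ /(_ i) [g [gf gd gr]]].
have /choice[h hg] : forall n, exists x, holds d [:: x] (g n).
  by move=> n; apply: morley_consistent (gr n).
exists h; split=> [m n E|n]; last exact: gf (hg n).
by apply: contrapT => mn; apply: (gd m n (h m) mn (hg m)); rewrite E.
Qed.
End Rank.

(** An equation x' = g(x) over L defines a set of Morley rank 1 and degree 1, whose
    generic type is therefore stationary. *)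
Section Stationary.
Variables (U : fieldType) (d : U -> U).
Hypotheses (char0 : [pchar U] =i pred0) (dder : derivation d)
  (dc : differentially_closed d) (sat : saturated d).
Variables (L : set U) (g : {poly U}).
Hypotheses (Linf : infinite_set L) (Ls : small L) (Lg : polyIn L g).

Let phi : formula U := Eq (Der (Var _ 0)) (tpoly g (Var _ 0)).
Let phiE x : holds d [:: x] phi <-> d x = g.[x].
Proof. by rewrite /= eval_tpoly. Qed.
Let phi_over : formula_over L phi. Proof. by split=> //; apply: over_tpoly. Qed.

Let inf_ext B : L `<=` B -> infinite_set B.
Proof. by move=> LB; exact: sub_infinite_set LB Linf. Qed.

Let g_values B e : L `<=` B -> polyIn (values d B e) g.
Proof. by move=> LB i; apply: sub_values; apply: LB. Qed.

(** All solutions that are transcendental over B have the same type over B; this is the source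
    of both strong minimality and the uniqueness of nonforking extensions. *)
Lemma generic_equiv B x y : L `<=` B -> small B -> d x = g.[x] -> d y = g.[y] ->
  ~ alg_closure (values d B [::]) x -> ~ alg_closure (values d B [::]) y ->
  forall f, formula_over B f -> holds d [:: x] f <-> holds d [:: y] f.
Proof.
move=> LB Bs dx dy nx ny f Bf.
apply: (qf_equiv_elementary char0 dder dc sat (inf_ext LB) Bs) Bf.
by apply: qf_equiv_generic dx dy nx ny => //; exact: g_values.
Qed.

Lemma small_add_seq (s : seq U) : small (L `|` [set` s]).
Proof.
apply: sub_small (values_small d s Linf Ls) => x [Lx|sx]; first exact: sub_values.
by have := values_env d L s (index x s); rewrite nth_index.
Qed.

(** Two infinite definable sets of solutions meet: each contains a solution transcendental
    over the parameters, by saturation, and these have the same type. *)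
Lemma strongly_minimal f1 f2 (h1 h2 : nat -> U) : injective h1 -> injective h2 ->
  (forall k, d (h1 k) = g.[h1 k] /\ holds d [:: h1 k] f1) ->
  (forall k, d (h2 k) = g.[h2 k] /\ holds d [:: h2 k] f2) ->
  exists x, holds d [:: x] f1 /\ holds d [:: x] f2.
Proof.
move=> i1 i2 H1 H2; pose B := L `|` [set` params f1 ++ params f2].
have LB : L `<=` B by move=> x; left.
have Bs : small B by exact: small_add_seq.
have pB : [set` params f1 ++ params f2] `<=` B by move=> x; right.
have B1 : formula_over B f1.
  exact: formula_over_sub (subset_trans (@sub_cat_l _ _ _) pB) (formula_over_params f1).
have B2 : formula_over B f2.
  exact: formula_over_sub (subset_trans (@sub_cat_r _ _ _) pB) (formula_over_params f2).
have vs := values_small d [::] (inf_ext LB) Bs; have vr := values_subring d B [::].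
have vB := @sub_values _ d B [::].
have gen f (h : nat -> U) : formula_over B f -> injective h ->
    (forall k, d (h k) = g.[h k] /\ holds d [:: h k] f) ->
    exists x, holds d [:: x] (And phi f) /\ ~ alg_closure (values d B [::]) x.
  move=> Bf hi Hh; apply: realize_nonalgebraic => //.
    by split; apply: formula_over_sub vB _ => //; apply: formula_over_sub phi_over.
  move=> p _ p0; have [k hk] := injective_nonroot hi p0; have [? ?] := Hh k.
  by exists (h k); split=> //; split=> //; apply/phiE.
have [x [[/phiE dx f1x] nx]] := gen _ _ B1 i1 H1.
have [y [[/phiE dy f2y] ny]] := gen _ _ B2 i2 H2.
by exists x; split=> //; apply/(generic_equiv LB Bs dx dy nx ny B2).
Qed.

(** A finite set of solutions of f could be added to the parameters, and f would also hold
    at a solution transcendental over them. *)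
Lemma generic_infinite B x f : L `<=` B -> small B -> d x = g.[x] ->
  ~ alg_closure (values d B [::]) x -> formula_over B f -> holds d [:: x] f ->
  exists h : nat -> U, injective h /\ forall k, holds d [:: h k] f.
Proof.
move=> LB Bs dx nx Bf fx; have Binf := inf_ext LB.
have [/finite_seqP[s Hs]|] := pselect (finite_set [set y | holds d [:: y] f]); last first.
  move=> /infiniteP /(card_leE x)[h [hf hi]]; exists h; split=> [m n|k]; first exact: hi.
  exact: hf.
have vr := values_subring d B s.
have [y [dy ny]] := generic_solution char0 dc sat vr (values_small d s Binf Bs) (g_values s LB).
have ny' : ~ alg_closure (values d B [::]) y.
  apply: contra_not ny; apply: alg_closure_sub; apply: values_min.
  - exact: vr.
  - exact: values_der.
  - exact: sub_values.
  - by move=> i; rewrite nth_nil; exact: subring0 vr.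
have fy := (generic_equiv LB Bs dx dy nx ny' Bf).1 fx.
case: ny; apply: (sub_alg_closure vr).
have sy : y \in s by have : [set` s] y by rewrite -Hs.
by have := values_env d B s (index y s); rewrite nth_index.
Qed.

(** Rank at least 1 because formulas of the type have infinitely many solutions, and not
    more by strong minimality of the equation. *)
Lemma generic_rank B x c : L `<=` B -> small B -> d x = g.[x] ->
  ~ alg_closure (values d B [::]) x -> type_morley_ge d c (tp d B x) <-> low c.
Proof.
move=> LB Bs dx nx; split; last first.
  by move=> lc f [Bf fx]; apply: (morley_low lc); exact: (generic_infinite LB Bs dx nx Bf fx).
have phix : tp d B x phi by split; [exact: formula_over_sub phi_over|apply/phiE].
move=> /(_ phi phix); case: c => T b [_ H] i; case E: (b i) => [V b'] j.
have [G [Gphi Gd Gr]] := H i; rewrite E in Gr.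
have [h0 [i0 H0]] := infinite_of_morley j (Gr 0%N).
have [h1 [i1 H1]] := infinite_of_morley j (Gr 1%N).
have [|k|y [y0 y1]] := strongly_minimal (f1 := G 0%N) (f2 := G 1%N) i0 i1 _ _.
- by move=> k; split=> //; apply/phiE; apply: Gphi (H0 k).
- by split=> //; apply/phiE; apply: Gphi (H1 k).
- exact: (Gd 0%N 1%N y) y0 y1.
Qed.

(** The nonforking extension to B is the type of a solution transcendental over B. An
    algebraic solution satisfies a formula over B with finitely many solutions, so the
    rank of its type is 0. *)
Theorem stationary_generic y : d y = g.[y] -> ~ alg_closure (values d L [::]) y ->
  stationary d L (tp d L y).
Proof.
move=> dy ny B LB Bs; have Binf := inf_ext LB.
have vr := values_subring d B [::].
have [y' [dy' ny']] := generic_solution char0 dc sat vr (values_small d [::] Binf Bs) (g_values [::] LB).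
have LL : L `<=` L by [].
have vLB : values d L [::] `<=` values d B [::].
  apply: values_min => //; first exact: values_der.
    by move=> x /LB; exact: sub_values.
  by move=> i; exact: values_env.
have nyL : ~ alg_closure (values d L [::]) y' by apply: contra_not ny'; exact: alg_closure_sub.
have rk c := generic_rank c LL Ls dy ny.
exists (tp d B y'); split.
  split; first exact: complete_tp.
  - move=> f [Lf fy]; split; first exact: formula_over_sub Lf.
    exact/(generic_equiv LL Ls dy dy' ny nyL Lf).
  - by move=> c; rewrite rk; exact: generic_rank.
move=> q [qc pq qrk]; have [qB qfs _] := qc.
have [x xq] := sat Bs qB qfs.
have qE := complete_type_tp qc xq.
have dx : d x = g.[x] by apply/phiE; apply: xq; apply: pq; split=> //; apply/phiE.
suff nx : ~ alg_closure (values d B [::]) x.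
  rewrite qE; apply/seteqP; split=> f [Bf fx]; split=> //.
    exact/(generic_equiv LB Bs dy' dx ny' nx Bf).
  exact/(generic_equiv LB Bs dx dy' nx ny' Bf).
move=> /(alg_closureP _ vr)[p [Bp p0 px]].
have /choice[t Ht] : forall i, exists t, term_over B t /\ p`_i = eval d [::] t.
  by move=> i; have [t ? ?] := Bp i; exists t.
pose pt := tsum [seq Mul (tclose (t i)) (texp (Var U 0) i) | i <- iota 0 (size p)].
have ptE u : eval d [:: u] pt = p.[u].
  rewrite /pt eval_tsum horner_coef -(big_mkord predT (fun i => p`_i * u ^+ i)) /index_iota subn0.
  by apply: eq_bigr => i _; rewrite /= eval_texp eval_tclose; have [_ ->] := Ht i.
have qf : q (Eq pt (Zero _)).
  rewrite qE; split; last by rewrite /= ptE.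
  split=> //; apply: over_tsum => i; split; first by apply: tclose_over; have [] := Ht i.
  exact: over_texp.
(* q has the rank of the type of y, which is at least 1, so that no formula of q has only
   finitely many solutions. *)
pose one := osup (fun _ : unit => osup (fun e : False => match e with end : ordinal_tree)).
have : low one by [].
move=> /rk /qrk /(_ _ qf) /(infinite_of_morley tt)[h [hi hp]].
have [k /eqP] := injective_nonroot hi p0; apply; have := hp k; by rewrite /= ptE.
Qed.
End Stationary.

(** * Constant extensions and the equation t' = a t *)

Section Subfields.
Variable U : fieldType.
Implicit Types (A M S : set U).

Lemma subfieldP A : subfield A <-> is_subring A /\ (forall x, A x -> A x^-1).
Proof.
split=> [[A1 AB Ad]|[Ar AV]].
  have AV x : A x -> A x^-1.
    by move=> /mem_set Ax; rewrite -div1r; apply: set_mem; exact: Ad.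
  split=> //; split=> [|x y Ax Ay|x y Ax Ay]; first exact: set_mem.
    by apply: set_mem; apply: AB; exact: mem_set.
  by rewrite -(invrK y); apply: set_mem; apply: Ad; apply: mem_set => //; exact: AV.
split=> [|x y /set_mem Ax /set_mem Ay|x y /set_mem Ax /set_mem Ay]; apply: mem_set.
- exact: subring1 Ar.
- exact: (subringB Ar Ax Ay).
- by apply: (subringM Ar Ax); exact: AV.
Qed.

(** The fraction field of S inside U; the junk quotients a / 0 = 0 are harmless. *)
Definition quotients S : set U := [set u | exists a b, [/\ S a, S b & u = a / b]].

Section Quotients.
Variables (S : set U) (Sr : is_subring S).

Lemma sub_quotients : S `<=` quotients S.
Proof. by move=> u Su; exists u, 1; rewrite divr1; split=> //; exact: subring1 Sr. Qed.

Lemma quotients_subfield : subfield (quotients S).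
Proof.
apply/subfieldP; split; last by move=> _ [a [b [Sa Sb ->]]]; exists b, a; rewrite invf_div.
split=> [|_ _ [a [b [Sa Sb ->]]] [a' [b' [Sa' Sb' ->]]]|_ _ [a [b [Sa Sb ->]]] [a' [b' [Sa' Sb' ->]]]].
- by apply: sub_quotients; exact: subring1 Sr.
- have [->|b0] := eqVneq b 0.
    exists (- a'), b'; split=> //; first exact: (subringN Sr Sa').
    by rewrite invr0 mulr0 sub0r mulNr.
  have [->|b0'] := eqVneq b' 0.
    by exists a, b; split=> //; rewrite invr0 mulr0 subr0.
  exists (a * b' - a' * b), (b * b'); split; last by field; rewrite ?b0' ?b0.
    by apply: subringB => //; apply: subringM.
  exact: subringM.
- exists (a * a'), (b * b'); split; try exact: subringM.
  by rewrite mulf_div.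
Qed.

Lemma common_denominator (s : seq U) : {in s, forall x, quotients S x} ->
  exists b, [/\ S b, b != 0 & forall x, x \in s -> S (b * x)].
Proof.
elim: s => [|x s IH] H; first by exists 1; split=> //; [exact: subring1 Sr|exact: oner_neq0].
have [b [Sb b0 Hb]] := IH (fun y ys => H y (mem_behead (s := x :: s) ys)).
have [a [b' [Sa Sb' xE]]] := H x (mem_head _ _).
have [b'0|b'0] := eqVneq b' 0.
  exists b; split=> // y; rewrite inE => /orP[/eqP->|/Hb//].
  by rewrite xE b'0 invr0 !mulr0; exact: subring0 Sr.
exists (b * b'); split; [exact: subringM|by rewrite mulf_neq0|move=> y].
rewrite inE => /orP[/eqP->|/Hb ys].
  by rewrite xE (_ : b * b' * (a / b') = b * a); [exact: subringM|field].
by rewrite mulrAC; exact: subringM.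
Qed.

Lemma alg_closure_quotients : alg_closure (quotients S) `<=` alg_closure S.
Proof.
move=> x [p [/allP Qp p0 /rootP px]].
have [|b [Sb b0 Hb]] := @common_denominator p; first by move=> y /Qp /set_mem.
apply/alg_closureP => //; exists (b *: p); split.
- move=> i; rewrite coefZ; have [lt|ge] := ltnP i (size p); first by apply: Hb; exact: mem_nth.
  by rewrite nth_default // mulr0; exact: subring0 Sr.
- by rewrite scaler_eq0 negb_or b0.
- by rewrite hornerZ px mulr0.
Qed.
End Quotients.

Section Diff.
Variable d : U -> U.
Hypothesis dder : derivation d.
Let dd := d_is_der dder.

Lemma der_inv x : d x^-1 = - d x / x ^+ 2.
Proof.
have [->|x0] := eqVneq x 0; first by rewrite invr0 (der0 dd) oppr0 mul0r.
have := der1 dd; rewrite -(mulfV x0) (derM dd) => /eqP; rewrite addrC addr_eq0 => /eqP E.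
by apply: (mulfI x0); rewrite E; field.
Qed.

Lemma der_div x y : d (x / y) = (d x * y - x * d y) / y ^+ 2.
Proof.
have [->|y0] := eqVneq y 0; first by rewrite invr0 mulr0 (der0 dd) expr0n invr0 mulr0.
by rewrite (derM dd) der_inv; field.
Qed.

Lemma quotients_diff_subfield S : is_subring S -> (forall x, S x -> S (d x)) ->
  diff_subfield d (quotients S).
Proof.
move=> Sr Sd; split; first exact: quotients_subfield.
move=> _ [a [b [Sa Sb ->]]]; rewrite der_div.
exists (d a * b - a * d b), (b ^+ 2); split=> //; last exact: subringX.
by apply: subringB => //; apply: subringM => //; exact: Sd.
Qed.

Lemma diff_subfield_subring M : diff_subfield d M -> is_subring M.
Proof. by case=> /subfieldP[]. Qed.

Lemma values_diff_subfield M : diff_subfield d M -> values d M [::] `<=` M.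
Proof.
move=> Md; have Mr := diff_subfield_subring Md.
apply: values_min => //; first by case: Md.
by move=> i; rewrite nth_nil; exact: subring0 Mr.
Qed.

Lemma diff_adjoin_subfield K s : diff_subfield d (diff_adjoin d K s).
Proof.
split; last first.
  by move=> x Ax M [Md KM]; apply: Md.2; apply: Ax.
apply/subfieldP; split; last first.
  by move=> x Ax M MM; have [/subfieldP[_ MV] _] := MM.1; apply: MV; exact: Ax.
split=> [M MM|x y Ax Ay M MM|x y Ax Ay M MM]; have Mr := diff_subfield_subring MM.1.
- exact: subring1 Mr.
- exact: (subringB Mr (Ax M MM) (Ay M MM)).
- exact: (subringM Mr (Ax M MM) (Ay M MM)).
Qed.

Lemma sub_diff_adjoin K s : K `|` [set` s] `<=` diff_adjoin d K s.
Proof. by move=> x Kx M [_]; apply. Qed.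

Lemma diff_adjoin_quotients K s : diff_adjoin d K s `<=` quotients (values d K s).
Proof.
move=> x; apply; split.
  by apply: quotients_diff_subfield; [exact: values_subring|exact: values_der].
have vr := values_subring d K s.
move=> y [Ky|/= ys]; apply: sub_quotients => //; first exact: sub_values.
by have := values_env d K s (index y s); rewrite nth_index.
Qed.

Lemma quotients_values_small K s : infinite_set K -> small K -> small (quotients (values d K s)).
Proof.
move=> Kinf Ks.
pose h (t : term U) := if t is Add t1 t2 then eval d s t1 / eval d s t2 else 0.
apply: sub_small (small_image_terms h Kinf Ks) => _ [_ [_ [[t1 K1 ->] [t2 K2 ->] ->]]].
by exists (Add t1 t2).
Qed.
End Diff.
End Subfields.

(** How much a new constant c adds to a differential field M as regards the equation
    t' = a t. *)
Section Exponential.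
Variables (U : fieldType) (d : U -> U).
Hypothesis dder : derivation d.
Let dd := d_is_der dder.
Variables (M : set U) (c : U).
Hypotheses (Md : diff_subfield d M) (dc0 : d c = 0).
Let Mr : is_subring M. Proof. exact: diff_subfield_subring Md. Qed.
Let MV x : M x -> M x^-1. Proof. by case: Md => /subfieldP[_ +] _; apply. Qed.
Let MD x : M x -> M (d x). Proof. exact: Md.2. Qed.
Let dmap p i : (map_poly d p)`_i = d p`_i. Proof. by rewrite coef_map_id0 ?(der0 dd). Qed.

Lemma polyIn_map_der p : polyIn M p -> polyIn M (map_poly d p).
Proof. by move=> Mp i; rewrite dmap; exact: MD. Qed.

Lemma size_map_der p : (size (map_poly d p) <= size p)%N.
Proof. by apply/leq_sizeP => j jp; rewrite dmap nth_default ?(der0 dd). Qed.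

Lemma der_const_horner p : d p.[c] = (map_poly d p).[c].
Proof. by rewrite (der_horner dd) dc0 mulr0 addr0. Qed.

Lemma adj_const_diff_subfield : diff_subfield d (quotients (adj M c)).
Proof.
apply: quotients_diff_subfield => //; first exact: adj_subring.
by move=> _ [p Mp ->]; rewrite der_const_horner; exists (map_poly d p) => //; exact: polyIn_map_der.
Qed.

(** Write t = P(c) / Q(c) with Q monic of minimal degree. Deriving t Q(c) = P(c) gives
    t Q^d(c) = (P^d - A P)(c), where ^d is the derivation of the coefficients. Since Q is monic,
    Q^d has smaller degree than Q, so it is 0, and then P^d = A P as c is transcendental. *)
Lemma exp_transcendental t A : ~ alg_closure M c -> polyIn M A -> quotients (adj M c) t ->
  d t = A.[c] * t -> t != 0 -> exists P, [/\ polyIn M P, P != 0 & map_poly d P = A * P].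
Proof.
move=> nc MA [_ [_ [[P0 MP0 ->] [Q0 MQ0 ->] tE]]] dt t0.
pose R k := `[< exists P Q, [/\ polyIn M P, polyIn M Q, Q != 0, t * Q.[c] = P.[c] & size Q = k] >].
have exR : exists k, R k.
  have Qc0 : Q0.[c] != 0 by apply: contra_neq t0 => E; rewrite tE E invr0 mulr0.
  exists (size Q0); apply/asboolP; exists P0, Q0; split=> //; last by rewrite tE divfK.
  by apply: contra_neq Qc0 => ->; rewrite horner0.
have [k /asboolP[P1 [Q1 [MP1 MQ1 Q10 tQ1 szQ1]]] kmin] := ex_minnP exR.
pose P := (lead_coef Q1)^-1 *: P1; pose Q := (lead_coef Q1)^-1 *: Q1.
have lQ0 : lead_coef Q1 != 0 by rewrite lead_coef_eq0.
have ML : M (lead_coef Q1)^-1 by apply: MV; exact: MQ1.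
have MP : polyIn M P by exact: polyInZ.
have MQ : polyIn M Q by exact: polyInZ.
have Q_0 : Q != 0 by rewrite scaler_eq0 negb_or invr_neq0.
have Qc0 : Q.[c] != 0 by apply/eqP => /(not_alg_eq0 Mr nc MQ) /eqP; rewrite (negPf Q_0).
have tQ : t * Q.[c] = P.[c] by rewrite !hornerZ -tQ1; ring.
have szQ : size Q = k by rewrite size_scale ?invr_neq0.
have lQ : lead_coef Q = 1 by rewrite lead_coefZ mulVf.
(* Q is monic and its leading coefficient 1 has derivative 0. *)
have szDQ : (size (map_poly d Q) < k)%N.
  have k0 : (0 < k)%N by rewrite -szQ size_poly_gt0.
  rewrite -(prednK k0) ltnS; apply/leq_sizeP => j jk; rewrite dmap.
  move: jk; rewrite leq_eqVlt => /orP[/eqP <-|]; first by rewrite -szQ -lead_coefE lQ (der1 dd).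
  by rewrite (prednK k0) -szQ => ge; rewrite nth_default ?(der0 dd).
have tDQ : t * (map_poly d Q).[c] = (map_poly d P - A * P).[c].
  have := congr1 d tQ; rewrite (derM dd) !der_const_horner dt => E.
  by rewrite hornerD hornerN hornerM -E -tQ; ring.
have DQ0 : map_poly d Q = 0.
  apply/eqP; apply: contraT => n0; move: szDQ; rewrite ltnNge kmin //.
  apply/asboolP; exists (map_poly d P - A * P), (map_poly d Q); split=> //.
    by apply: polyInB => //; [exact: polyIn_map_der|exact: polyInM].
  exact: polyIn_map_der.
exists P; split=> //.
  by apply: contra_neq t0 => E; apply/eqP; move/eqP: tQ; rewrite E horner0 mulf_eq0 (negPf Qc0) orbF.
apply/eqP; rewrite -subr_eq0; apply/eqP; apply: (not_alg_eq0 Mr nc).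
  by apply: polyInB => //; [exact: polyIn_map_der|exact: polyInM].
by rewrite -tDQ DQ0 horner0 mulr0.
Qed.

(** For c algebraic with minimal polynomial f, M(c) = M[c] has the basis 1, c, ..., c^(m-1)
    over M with m the degree of f, and this basis consists of constants. *)
Section AlgebraicConstant.
Variable f : {poly U}.
Hypotheses (Mf : polyIn M f) (f0 : f != 0) (fc : f.[c] = 0).
Hypothesis fmin : forall g, polyIn M g -> g != 0 -> (size g < size f)%N -> g.[c] != 0.

Lemma alg_inverse g : polyIn M g -> g != 0 -> (size g < size f)%N ->
  exists2 v, polyIn M v & v.[c] * g.[c] = 1.
Proof.
move: {2}(size g) (leqnn (size g)) => m; elim: m g => [|m IH] g szg Mg g0 szgf.
  by move: szg g0; rewrite leqn0 size_poly_eq0 => ->.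
have [sz1|sz2] := leqP (size g) 1%N.
  exists (g`_0)^-1%:P; first by apply: polyInC => //; apply: MV; exact: Mg.
  have g00 : g`_0 != 0 by apply: contra_neq g0 => E; rewrite (size1_polyC sz1) E.
  by rewrite {2}(size1_polyC sz1) !hornerC mulVf.
have [k [q [r [Mq Mr' szr Efg]]]] := pseudo_division Mr Mg g0 Mf.
have Ec : q.[c] * g.[c] + r.[c] = 0.
  by have := congr1 (horner^~ c) Efg; rewrite hornerZ fc mulr0 hornerD hornerM.
have r0 : r != 0.
  apply/eqP => r0; move: Ec Efg; rewrite r0 hornerC !addr0 => /eqP.
  rewrite mulf_eq0 (negPf (fmin Mg g0 szgf)) orbF => qc Efg.
  have lf : lead_coef g ^+ k *: f != 0 by rewrite scaler_eq0 negb_or f0 expf_neq0 ?lead_coef_eq0.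
  have q0 : q != 0 by apply: contra_neq lf => q0; rewrite Efg q0 mul0r.
  have szq : (size q < size f)%N.
    have := size_scale_leq (lead_coef g ^+ k) f; rewrite Efg size_mul //.
    by move: sz2; move: (size g) (size q) (size f) => x y z; lia.
  by move: (fmin Mq q0 szq); rewrite qc.
have [||//||v Mv vr] := IH r.
- by rewrite -ltnS; apply: leq_trans szr szg.
- exact: Mr'.
- exact: ltn_trans szr szgf.
exists (- (v * q)).
  rewrite -sub0r; apply: polyInB => //; last exact: polyInM.
  by move=> i; rewrite coef0; exact: subring0 Mr.
move/eqP: Ec; rewrite addrC addr_eq0 => /eqP Ec.
by rewrite -vr Ec !hornerE; ring.
Qed.

Lemma alg_representation t : quotients (adj M c) t ->
  exists P, [/\ polyIn M P, (size P < size f)%N & t = P.[c]].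
Proof.
have reduce P : polyIn M P -> exists P', [/\ polyIn M P', (size P' < size f)%N & P.[c] = P'.[c]].
  move=> MP; have [k [q [r [Mq Mr' szr E]]]] := pseudo_division Mr Mf f0 MP.
  have l0 : lead_coef f ^+ k != 0 by rewrite expf_neq0 ?lead_coef_eq0.
  exists ((lead_coef f ^+ k)^-1 *: r); split.
  - by apply: polyInZ => //; apply: MV; apply: subringX => //; exact: Mf.
  - by rewrite size_scale ?invr_neq0.
  - apply: (mulfI l0); rewrite -hornerZ E hornerD hornerM fc mulr0 add0r hornerZ.
    by rewrite mulrA mulfV ?mul1r.
move=> [_ [_ [[P MP ->] [Q MQ ->] ->]]].
have [Q' [MQ' szQ' ->]] := reduce Q MQ.
have [->|Q0] := eqVneq Q' 0.
  exists 0; rewrite horner0 invr0 mulr0 size_poly0 size_poly_gt0; split=> // i.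
  by rewrite coef0; exact: subring0 Mr.
have [v Mv vQ] := alg_inverse MQ' Q0 szQ'.
have [P' [MP' szP' E]] := reduce (P * v) (polyInM Mr MP Mv).
exists P'; split=> //; rewrite -E hornerM; congr (_ * _).
have Qc0 : Q'.[c] != 0 by exact: fmin.
by apply: (mulIf Qc0); rewrite vQ mulVf.
Qed.
End AlgebraicConstant.

Definition no_exp a (N : set U) := forall t, N t -> d t = a * t -> t = 0.

(** In the algebraic case the coordinates of a solution t on the basis of powers of c are
    solutions in M; in the transcendental case so are the coefficients of P. *)
Lemma no_exp_const a : M a -> no_exp a M -> no_exp a (quotients (adj M c)).
Proof.
move=> Ma noM t tN dt; apply/eqP; apply: contraT => t0.
have coefs P : map_poly d P = a%:P * P -> polyIn M P -> P = 0.
  move=> E MP; apply/polyP => i; rewrite coef0; apply: noM => //.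
  by rewrite -dmap E coefCM.
have [ca|nc] := pselect (alg_closure M c); last first.
  have [|P [MP P0 E]] := exp_transcendental nc (polyInC Mr Ma) tN _ t0; first by rewrite hornerC.
  by move: P0; rewrite (coefs P) // eqxx.
pose R k := `[< exists p, [/\ polyIn M p, p != 0, p.[c] = 0 & size p = k] >].
have exR : exists k, R k.
  by have [p [Mp p0 pc]] := (alg_closureP c Mr).1 ca; exists (size p); apply/asboolP; exists p.
have [k /asboolP[f [Mf f0 fc szf]] kmin] := ex_minnP exR.
have fmin g : polyIn M g -> g != 0 -> (size g < size f)%N -> g.[c] != 0.
  move=> Mg g0; rewrite szf => lt; apply/eqP => gc; move: lt; rewrite ltnNge kmin //.
  by apply/asboolP; exists g.
have [P [MP szP tE]] := alg_representation Mf f0 fc fmin tN.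
have E : map_poly d P = a%:P * P.
  apply/eqP; rewrite -subr_eq0; apply: contraT => n0.
  have Mn : polyIn M (map_poly d P - a%:P * P).
    by apply: polyInB => //; [exact: polyIn_map_der|apply: polyInM => //; exact: polyInC].
  have lt : (size (map_poly d P - a%:P * P)%R < size f)%N.
    apply: leq_ltn_trans szP; apply: leq_trans (size_polyD _ _) _.
    by rewrite geq_max size_map_der size_polyN mul_polyC size_scale_leq.
  move: (fmin _ Mn n0 lt).
  by rewrite hornerD hornerN hornerM hornerC -der_const_horner -tE dt subrr eqxx.
by move: t0; rewrite tE (coefs P) // horner0 eqxx.
Qed.

(** Here P^d = X P, which is impossible because P^d has at most the degree of P. *)
Lemma no_exp_transcendental : ~ alg_closure M c -> no_exp c (quotients (adj M c)).
Proof.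
move=> nc t tN dt; apply/eqP; apply: contraT => t0.
have MX : polyIn M 'X by rewrite -['X]expr1; exact: polyInXn.
have [|P [MP P0 E]] := exp_transcendental nc MX tN _ t0; first by rewrite hornerX.
by have := size_map_der P; rewrite E mulrC size_mulX // ltnn.
Qed.
End Exponential.

Section Tower.
Variables (U : fieldType) (d : U -> U).
Hypothesis dder : derivation d.

Lemma no_exp_tower a M (cs : seq U) : diff_subfield d M -> M a -> no_exp d a M ->
  [set` cs] `<=` constants d ->
  exists N, [/\ diff_subfield d N, M `<=` N, no_exp d a N & [set` cs] `<=` N].
Proof.
elim: cs M => [|c cs IH] M Md Ma noM csC; first by exists M; split.
have dc0 : d c = 0 by apply: (csC c); rewrite /= mem_head.
have Mr := diff_subfield_subring Md.
have MN : M `<=` quotients (adj M c).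
  by apply: subset_trans (sub_quotients (adj_subring Mr c)); exact: sub_adj.
have [|||x xs|N [Nd QN noN csN]] := IH (quotients (adj M c)).
- exact: adj_const_diff_subfield.
- exact: MN.
- exact: no_exp_const.
- by apply: csC; rewrite /= inE xs orbT.
exists N; split=> //; first exact: subset_trans QN.
move=> x /=; rewrite inE => /orP[/eqP ->|]; last exact: csN.
by apply: QN; apply: sub_quotients; [exact: adj_subring|exact: adj_gen].
Qed.
End Tower.

(** * The equation z'' = z z' *)

Section Riccati.
Variables (U : fieldType) (d : U -> U).
Hypothesis dder : derivation d.
Let dd := d_is_der dder.
Hypothesis two_neq0 : 2%:R != 0 :> U.

Lemma der_half : d 2%:R^-1 = 0.
Proof. by rewrite (der_inv dder) (derMn dd) (der1 dd) mul0rn oppr0 mul0r. Qed.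

Lemma der_sqr x : d (x ^+ 2) = 2%:R * x * d x.
Proof. by rewrite expr2 (derM dd); ring. Qed.

(** The Moebius transformation that sends the constant solutions a and -a of
    y' = (y^2 - a^2) / 2 to 0 and to infinity linearizes the equation. *)
Lemma riccati_exp a y : d a = 0 -> d y = (y ^+ 2 - a ^+ 2) / 2%:R -> y + a != 0 ->
  d ((y - a) / (y + a)) = a * ((y - a) / (y + a)).
Proof.
move=> da dy ya; rewrite (der_div dder) (derB dd) (derD dd) da dy.
by field; rewrite two_neq0 ya.
Qed.

(** The equation z'' = z z' says that z' - z^2 / 2 has derivative 0. *)
Lemma first_integral z : d (d z) = z * d z -> d (d z - z ^+ 2 / 2%:R) = 0.
Proof. by move=> E; rewrite (derB dd) (derM dd) der_half der_sqr E; field. Qed.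
End Riccati.

Section Independence.
Variables (U : fieldType) (K : set U).
Hypotheses (char0 : [pchar U] =i pred0) (Kf : subfield K).
Let Kr : is_subring K. Proof. by case/subfieldP: Kf. Qed.
Let KV x : K x -> K x^-1. Proof. by have /subfieldP[_ H] := Kf; exact: H. Qed.

Lemma char0_infinite : infinite_set K.
Proof.
apply/infiniteP/(card_leE 0); exists (fun n => n%:R); split=> [n _|m n _ _].
  by apply: subringMn => //; exact: subring1 Kr.
wlog mn : m n / (m <= n)%N => [H|/eqP].
  by case/orP: (leq_total m n) => ? E; [|symmetry]; apply: H.
rewrite eq_sym -subr_eq0 -natrB //; move/pcharf0P: char0 => ->.
by rewrite subn_eq0 => nm; apply/eqP; rewrite eqn_leq mn.
Qed.

Lemma half_in : K 2%:R^-1.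
Proof. by apply: KV; apply: subringMn => //; exact: subring1 Kr. Qed.

(** The change of variables (z, z') -> (z, z' - z^2 / 2) is triangular, so it preserves
    algebraic independence over K. *)
Lemma triangular_indep (z z' : U) (n : nat) (q : nat -> {poly U}) :
  alg_indep K [tuple z; z'] -> (forall i, polyIn K (q i)) ->
  \sum_(i < n) (q i).[z' - z ^+ 2 / 2%:R] * z ^+ i = 0 -> forall i, (i < n)%N -> q i = 0.
Proof.
move=> indep Kq E i lt_in.
have two0 : 2%:R != 0 :> U by exact: char0_neq0.
pose X0 : {mpoly U[2]} := 'X_ord0; pose X1 : {mpoly U[2]} := 'X_(lift ord0 ord0).
pose Y := X1 - (2%:R^-1)%:MP * X0 ^+ 2.
pose P := \sum_(j < n) (map_poly (@mpolyC 2 U) (q j)).[Y] * X0 ^+ j.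
have PE (v : 'I_2 -> U) : P.@[v] =
    \sum_(j < n) (q j).[v (lift ord0 ord0) - v ord0 ^+ 2 / 2%:R] * v ord0 ^+ j.
  rewrite raddf_sum; apply: eq_bigr => j _ /=; rewrite mevalM rmorphXn /= mevalXU; congr (_ * _).
  rewrite -(horner_map (meval v)) /= mevalB mevalM mevalC rmorphXn /= !mevalXU -map_poly_comp.
  congr (_.[_]); last by rewrite mulrC.
  by apply/polyP => k; rewrite coef_map_id0 /= mevalC.
pose KP := [set p : {mpoly U[2]} | mpolyIn K p].
have KPr : is_subring KP.
  split; [by apply: mpolyInC => //; exact: subring1 Kr|exact: mpolyInB|exact: mpolyInM].
have KX k : KP 'X_k by exact: mpolyInX.
have KY : KP Y.
  apply: (subringB KPr (KX _)); apply: (subringM KPr); last exact: (subringX KPr 2 (KX _)).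
  by apply: mpolyInC => //; exact: half_in.
have KPP : KP P.
  apply: (subring_sum KPr) => j _; apply: (subringM KPr); last exact: (subringX KPr j (KX _)).
  apply: (polyIn_horner KPr) => // k; rewrite coef_map_id0 ?mpolyC0 //.
  by apply: mpolyInC => //; exact: Kq.
have P0 : P = 0.
  apply: indep; last by rewrite PE !(tnth_nth 0).
  by apply/allP => _ /mapP[m _ ->]; apply: mem_set; exact: KPP.
apply: (poly_vanish char0) => c.
have r0 : \poly_(j < n) (q j).[c] = 0.
  apply: (poly_vanish char0) => u; rewrite horner_poly.
  (* The inverse change of variables. *)
  pose v (k : 'I_2) := if k == ord0 then u else c + u ^+ 2 / 2%:R.
  have := PE v; rewrite P0 meval0 => /esym; rewrite /v /= => H.
  by rewrite -[RHS]H; apply: eq_bigr => j _; rewrite addrK.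
by have := congr1 (fun p : {poly U} => p`_i) r0; rewrite coef_poly lt_in coef0.
Qed.
End Independence.

Section Main.
Variables (U : fieldType) (d : U -> U).
Hypothesis hU : saturated_DCF0 d.
Variable K : set U.
Hypotheses (hK : subfield K) (hKC : K `<=` constants d) (hKs : small K).
Variable z : U.
Hypotheses (hz : d (d z) / d z = z) (hgen : alg_indep K [tuple z; d z]).

Let char0 : [pchar U] =i pred0. Proof. by case: hU. Qed.
Let dder : derivation d. Proof. by case: hU. Qed.
Let dc : differentially_closed d. Proof. by case: hU. Qed.
Let sat : saturated d. Proof. by case: hU. Qed.
Let dd := d_is_der dder.
Let two0 : 2%:R != 0 :> U. Proof. exact: char0_neq0. Qed.
Let Kinf : infinite_set K. Proof. exact: char0_infinite. Qed.
Let Kr : is_subring K. Proof. by case/subfieldP: hK. Qed.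
Let Kd : diff_subfield d K.
Proof. by split=> // x /hKC dx; rewrite (dx : d x = 0); exact: subring0 Kr. Qed.
Let Khalf : K 2%:R^-1. Proof. exact: half_in. Qed.
Let valuesK : values d K [::] `<=` K. Proof. exact: values_diff_subfield. Qed.

Let c := d z - z ^+ 2 / 2%:R.

Lemma z_eq : d (d z) = z * d z.
Proof.
have [dz0|dz0] := eqVneq (d z) 0; first by rewrite dz0 (der0 dd) mulr0.
by rewrite -[X in X * _]hz divfK.
Qed.

Lemma first_integral_const : d c = 0. Proof. exact: first_integral z_eq. Qed.

Lemma z_riccati : d z = z ^+ 2 / 2%:R + c. Proof. by rewrite addrC subrK. Qed.

Lemma c_transcendental : ~ alg_closure K c.
Proof.
move=> /(alg_closureP _ Kr)[p [Kp p0 pc]].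
have := @triangular_indep _ _ char0 hK z (d z) 1 (fun=> p) hgen (fun=> Kp).
rewrite big_ord1 expr0 mulr1 => /(_ pc 0%N (ltnSn _)) pE.
by move: p0; rewrite pE eqxx.
Qed.

Lemma values_const x : d x = 0 -> values d K [:: x] `<=` adj K x.
Proof.
move=> dx; apply: values_min.
- exact: adj_subring.
- move=> _ [p Kp ->]; rewrite (der_const_horner dder dx); exists (map_poly d p) => //.
  exact: polyIn_map_der.
- exact: sub_adj.
- case=> [|i] /=; first exact: adj_gen.
  by rewrite nth_nil; exact: subring0 (adj_subring Kr x).
Qed.

Lemma z_transcendental : ~ alg_closure (values d K [:: c]) z.
Proof.
move=> /(alg_closure_sub (values_const first_integral_const)).
move=> /(alg_closureP _ (adj_subring Kr c))[p [Kp p0 pz]].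
have /choice[q Hq] : forall i, exists q, polyIn K q /\ p`_i = q.[c].
  by move=> i; have [q ? ?] := Kp i; exists q.
have := @triangular_indep _ _ char0 hK z (d z) (size p) q hgen (fun i => (Hq i).1) _.
move=> H; case/eqP: p0; apply/polyP => i; rewrite coef0.
have [lt|ge] := ltnP i (size p); last by rewrite nth_default.
rewrite (Hq i).2 H ?horner0 // -[RHS]pz horner_coef.
by apply: eq_bigr => j _; rewrite (Hq j).2.
Qed.

Let g : {poly U} := 2%:R^-1 *: 'X^2 + c%:P.
Let gE x : g.[x] = x ^+ 2 / 2%:R + c.
Proof. by rewrite hornerD hornerZ hornerXn hornerC mulrC. Qed.

Let L := diff_adjoin d K [:: c].
Let Ld : diff_subfield d L. Proof. exact: diff_adjoin_subfield. Qed.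
Let Lr : is_subring L. Proof. exact: diff_subfield_subring Ld. Qed.
Let KL : K `<=` L. Proof. by move=> x Kx; apply: sub_diff_adjoin; left. Qed.
Let Lc : L c. Proof. by apply: sub_diff_adjoin; right; rewrite /= mem_head. Qed.
Let Lg : polyIn L g.
Proof. by apply: polyInD; rewrite //; [apply: polyInZ (polyInXn _ _) => //; exact: KL|exact: polyInC]. Qed.
Let Linf : infinite_set L. Proof. exact: sub_infinite_set KL Kinf. Qed.
Let Ls : small L.
Proof. exact: sub_small (diff_adjoin_quotients dder (s := _)) (quotients_values_small _ _ Kinf hKs). Qed.

Lemma diff_adjoin0 : diff_adjoin d K [::] = K.
Proof.
apply/seteqP; split=> x; last by move=> Kx; apply: sub_diff_adjoin; left.
by apply; split=> // y [].
Qed.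

Lemma tp_solution B h x y : polyIn B h -> realizes d x (tp d B y) -> d y = h.[y] -> d x = h.[x].
Proof.
move=> Bh xr dy.
have := xr (Eq (Der (Var _ 0)) (tpoly h (Var _ 0))); rewrite /= eval_tpoly; apply; split.
  by split=> //; exact: over_tpoly.
by rewrite /= eval_tpoly.
Qed.

Lemma c_step : stationary d K (tp d K c) /\ internal d K (tp d K c).
Proof.
have K0 : polyIn K 0 by move=> i; rewrite coef0; exact: subring0 Kr.
have dcE : d c = (0 : {poly U}).[c] by rewrite horner0 first_integral_const.
split.
  apply: (stationary_generic char0 dder dc sat Kinf hKs K0 dcE).
  by move=> /(alg_closure_sub valuesK); exact: c_transcendental.
exists K; split=> // y yr; exists [:: y].
  move=> x /=; rewrite mem_seq1 => /eqP ->.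
  by rewrite /constants /= (tp_solution K0 yr dcE) horner0.
by move=> M [_]; apply; right; rewrite /= mem_head.
Qed.

Lemma sqrt_exists (b : U) : exists a, a ^+ 2 = b.
Proof.
have [||a [Ha _]] := blum char0 dc (n := 0) (F := 'X^2 - (b%:MP)%:P) (G := 1).
- by rewrite size_XnsubC.
- exact: oner_neq0.
exists a; move: Ha; rewrite rmorphB /= map_polyXn map_polyC /= !hornerE mevalC => /eqP.
by rewrite subr_eq0 => /eqP.
Qed.

(** With a^2 = -2 c and a nonzero solution t0 of t' = a t, every solution y <> -a of the
    Riccati equation is a rational function of a, t0 and the constant ((y - a) / (y + a)) / t0. *)
Lemma z_step : stationary d L (tp d L z) /\ internal d L (tp d L z).
Proof.
have dz : d z = g.[z] by rewrite gE -z_riccati.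
split.
  apply: (stationary_generic char0 dder dc sat Linf Ls Lg dz).
  move=> /(alg_closure_sub (values_diff_subfield Ld)).
  move=> /(alg_closure_sub (diff_adjoin_quotients dder (s := _))).
  by move=> /(alg_closure_quotients (values_subring _ _ _)); exact: z_transcendental.
have [a a2] := sqrt_exists (- (2%:R * c)).
have c0 : c != 0.
  apply/eqP => c0; apply: c_transcendental; rewrite c0; apply: sub_alg_closure => //.
  exact: subring0 Kr.
have a0 : a != 0.
  apply/eqP => a0; move/eqP: a2; rewrite a0 expr0n eq_sym oppr_eq0 mulf_eq0 (negPf two0).
  by rewrite (negPf c0).
have cE : c = - a ^+ 2 / 2%:R by rewrite a2 opprK mulrC mulKf.
have da : d a = 0.
  have : d (a ^+ 2) = 0.
    rewrite a2 (derN dd) (derM dd) (derMn dd) (der1 dd) first_integral_const.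
    by rewrite mul0rn mul0r mulr0 addr0 oppr0.
  rewrite (der_sqr dder) => /eqP; rewrite !mulf_eq0 (negPf two0) (negPf a0) => /eqP //.
have [t0 [dt0 t00]] := blum1 char0 dc (a *: 'X) (negbT (polyX_eq0 U)).
rewrite hornerX in t00; rewrite hornerZ hornerX in dt0.
pose e := [:: c; a; t0]; pose F := quotients (values d K e).
have vr := values_subring d K e.
have ve := sub_quotients vr.
have Fd : diff_subfield d F by apply: quotients_diff_subfield => //; exact: values_der.
have [Ff _] := Fd.
have Fa : F a by apply: ve; exact: (values_env d K e 1).
have Ft : F t0 by apply: ve; exact: (values_env d K e 2).
exists F; split=> //.
- exact: quotients_values_small.
- move=> x; apply; split=> // y [Ky|/=]; first by apply: ve; exact: sub_values.
  by rewrite mem_seq1 => /eqP ->; apply: ve; exact: (values_env d K e 0).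
move=> y yr; have dy := tp_solution Lg yr dz; rewrite gE cE in dy.
have [ya|ya] := eqVneq (y + a) 0.
  exists [::] => //; move=> M [/subfieldP[Mr _] FM].
  have Fy : F y.
    move/eqP: ya; rewrite addr_eq0 => /eqP ->.
    exact: (subringN (diff_subfield_subring Fd) Fa).
  by apply: FM; left.
have {}dy : d y = (y ^+ 2 - a ^+ 2) / 2%:R by rewrite dy; ring.
pose s := (y - a) / (y + a) / t0.
have ds : d s = 0.
  rewrite /s (der_div dder) (riccati_exp dder two0 da dy ya) dt0.
  by apply/eqP; rewrite mulf_eq0; apply/orP; left; apply/eqP; ring.
exists [:: s]; first by move=> x /=; rewrite mem_seq1 => /eqP ->.
move=> M [/subfieldP[Mr MV] FM].
have Ms : M s by apply: FM; right; rewrite /= mem_head.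
have Ma : M a by apply: FM; left.
have Mt : M t0 by apply: FM; left.
have Mst := subringM Mr Ms Mt.
have stE : s * t0 = (y - a) / (y + a) by rewrite divfK.
have -> : y = a * (1 + s * t0) / (1 - s * t0).
  have -> : 1 - s * t0 = 2%:R * a / (y + a) by rewrite stE; field.
  by rewrite stE; field; rewrite two0 a0 ya.
apply: (subringM Mr); last by apply: MV; exact: (subringB Mr (subring1 Mr) Mst).
by apply: (subringM Mr Ma); exact: (subringD Mr (subring1 Mr) Mst).
Qed.

Lemma z_analyzable : analyzable_in_steps d 2 K z.
Proof.
exists [:: c; z] => //; split.
  apply: sub_alg_closure; first exact: diff_subfield_subring (diff_adjoin_subfield _ _ _).
  by apply: sub_diff_adjoin; right; rewrite /= !inE eqxx orbT.
case=> [|[|//]] _; right; rewrite /=.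
  by rewrite diff_adjoin0; exact: c_step.
exact: z_step.
Qed.

(** The type of z says that its first integral is transcendental over K and that z is
    transcendental over K and this first integral. *)
Lemma generic_realizes y b : d b = 0 -> ~ alg_closure K b ->
  d y = y ^+ 2 / 2%:R + b -> ~ alg_closure (values d K [:: b]) y -> realizes d y (tp d K z).
Proof.
move=> db nb dy ny f [Kf fz].
have qbc : qf_equiv d K [:: b] [:: c].
  apply: (qf_equiv_generic dder (g := 0)); rewrite ?horner0 ?first_integral_const //.
  - by move=> i; rewrite coef0; exact: subring0 (values_subring _ _ _).
  - by move=> /(alg_closure_sub valuesK).
  - by move=> /(alg_closure_sub valuesK); exact: c_transcendental.
pose h : {poly U * U} := (2%:R^-1, 2%:R^-1)%:P * 'X^2 + (b, c)%:P.
have pr := pair_values_subring d K [:: b] [:: c].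
have Kh : polyIn (pair_values d K [:: b] [:: c]) h.
  apply: polyInD => //; last by apply: polyInC => //; exists (Var _ 0).
  by apply: polyInM (polyInXn _ _) => //; apply: polyInC => //; exists (Par 2%:R^-1).
have hE : h.[(y, z)] = (d y, d z).
  by rewrite dy z_riccati hornerD hornerM !hornerC hornerXn; congr (_, _) => /=; rewrite -expr2 mulrC.
have q := qf_equiv_step dder qbc Kh hE ny z_transcendental.
(* A formula sees only y: the variables outside the environment are 0. *)
have q1 : qf_equiv d K [:: y] [:: z].
  move=> u pu; apply: q; apply: (pair_values_min _ _ _ _ pu).
  - exact: pair_values_subring.
  - exact: pair_values_der.
  - by move=> a Ka; exists (Par a).
  - by case=> [|i]; [exists (Var _ 0)|rewrite /= nth_nil; exists (Zero _)].
exact/(qf_equiv_elementary char0 dder dc sat Kinf hKs q1 Kf).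
Qed.

(** Over F take a transcendental constant a and a generic solution y with first integral
    -a^2 / 2. If y is rational over F and constants, so is the solution (y - a) / (y + a) of
    t' = a t; but F(a) has no nonzero solution, and adjoining constants adds none. *)
Lemma z_not_internal : ~ internal d K (tp d K z).
Proof.
case=> F [Fd Fs KF Fint].
have Fr := diff_subfield_subring Fd.
have Finf := sub_infinite_set KF Kinf.
have F0 : polyIn F 0 by move=> i; rewrite coef0; exact: subring0 Fr.
have [a [da na]] := generic_solution char0 dc sat Fr Fs F0.
rewrite horner0 in da.
have vr := values_subring d F [:: a].
have va : values d F [:: a] a by exact: (values_env d F [:: a] 0).
have vF := @sub_values _ d F [:: a].
pose b := - a ^+ 2 / 2%:R.
have vb : values d F [:: a] b.
  by apply: subringM => //; [apply: subringN => //; exact: subringX|apply: vF; apply: KF].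
pose h : {poly U} := 2%:R^-1 *: 'X^2 + b%:P.
have vh : polyIn (values d F [:: a]) h.
  by apply: polyInD => //; [apply: polyInZ (polyInXn _ _) => //; apply: vF; exact: KF|exact: polyInC].
have [y [dy ny]] := generic_solution char0 dc sat vr (values_small d [:: a] Finf Fs) vh.
have {}dy : d y = y ^+ 2 / 2%:R + b by rewrite dy hornerD hornerZ hornerXn hornerC [_ * y ^+ 2]mulrC.
have [cs csC ycs] : exists2 cs : seq U, [set` cs] `<=` constants d & adjoin F cs y.
  apply: Fint; apply: (generic_realizes (b := b)) => //.
  - by rewrite /b (derM dd) (derN dd) (der_sqr dder) da (der_half dder); ring.
  - move=> /(alg_closureP _ Kr)[p [Kp p0 pb]]; apply: na; apply/alg_closureP => //.
    have Fq : polyIn F (- 2%:R^-1 *: 'X^2).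
      by apply: polyInZ (polyInXn _ _) => //; apply: subringN => //; exact: KF.
    exists (p \Po (- 2%:R^-1 *: 'X^2)); split.
    + by apply: polyIn_comp => // i; apply: KF.
    + rewrite comp_poly_eq0 // size_scale ?size_polyXn //.
      by rewrite oppr_eq0 invr_eq0.
    + rewrite horner_comp hornerZ hornerXn -[RHS]pb; congr (_.[_]); rewrite /b; ring.
  - apply: contra_not ny; apply: alg_closure_sub; apply: values_min => //.
    + exact: values_der.
    + by move=> x /KF /vF.
    + by case=> [|i] //=; rewrite nth_nil; exact: subring0 vr.
have ar := adj_subring Fr a.
have noM : no_exp d a (quotients (adj F a)) by exact: no_exp_transcendental.
have Ma : quotients (adj F a) a by apply: sub_quotients => //; exact: adj_gen.
have [N [Nd MN noN csN]] := no_exp_tower dder (adj_const_diff_subfield dder Fd da) Ma noM csC.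
have [/subfieldP[Nr NV] _] := Nd.
have Ny : N y.
  apply: ycs; split; first by case: Nd.
  by move=> x [Fx|]; [apply: MN; apply: sub_quotients => //; exact: sub_adj|exact: csN].
have Na := MN _ Ma.
have nya x : values d F [:: a] x -> y != x.
  by move=> vx; apply/eqP => E; apply: ny; rewrite E; exact: sub_alg_closure.
have ya1 : y - a != 0 by rewrite subr_eq0; exact: nya.
have ya2 : y + a != 0 by rewrite addr_eq0; apply: nya; exact: subringN.
have {}dy : d y = (y ^+ 2 - a ^+ 2) / 2%:R by rewrite dy /b; ring.
have := noN ((y - a) / (y + a)) _ (riccati_exp dder two0 da dy ya2).
have Nt : N ((y - a) / (y + a)).
  by apply: (subringM Nr (subringB Nr Ny Na)); apply: NV; exact: (subringD Nr Ny Na).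
by move=> /(_ Nt) /eqP; rewrite mulf_eq0 invr_eq0 (negPf ya1) (negPf ya2).
Qed.

End Main.

Theorem lemma7p8 (U : fieldType) (d : U -> U) (hU : saturated_DCF0 d)
  (K : set U) (hK : subfield K) (hKC : K `<=` constants d) (hKs : small K)
  (z : U) (hz : d (d z) / d z = z) (hgen : alg_indep K [tuple z; d z]) :
  analyzable_in_steps d 2 K z /\ ~ internal d K (tp d K z).
Proof. by split; [exact: z_analyzable|exact: z_not_internal]. Qed.
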